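(* Fix $x_0\in\mathbb R^n$. Let $m\in\mathbb N$, $1\le p_k<\infty$, $1/p=\sum_{k=1}^m1/p_k$, $\vec\omega\in A_{\vec P}\cap(A_\infty)^m$, $v\in A_\infty$, and positive measurable $\varphi_{11},\dots,\varphi_{1m},\varphi_2$ on $\mathbb R^n\times(0,\infty)$ with $$\sup_{r>0}\varphi_2(x_0,r)^{-1}\int_r^\infty\frac{\operatorname*{ess\,inf}_{t<\eta<\infty}\prod_{i=1}^m\varphi_{1i}(x_0,\eta)\,\omega_i(B(x_0,\eta))^{1/p_i}}{\prod_{i=1}^m\omega_i(B(x_0,t))^{1/p_i}}\frac{dt}t<\infty.$$ Let $T$ be an $m$-sublinear operator on $\prod_iM^{p_i,\varphi_{1i}}_{x_0}(\omega_i)$ with $T\in LS\big(\prod_iM^{p_i,\varphi_{1i}}_{x_0}(\omega_i)\big)\cap LB\big(\prod_iM^{p_i,\varphi_{1i}}_{x_0}(\omega_i)\to M^{p,\varphi_2}_{x_0}(v)\big)$. (i) If $\min_kp_k>1$, $T$ is bounded from $\prod_{i=1}^mM^{p_i,\varphi_{1i}}_{x_0}(\omega_i)$ to $M^{p,\varphi_2}_{x_0}(v)$. (ii) If $\min_kp_k=1$, $T$ is bounded from $\prod_{i=1}^mM^{p_i,\varphi_{1i}}_{x_0}(\omega_i)$ to $WM^{p,\varphi_2}_{x_0}(v)$.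
   Context: A weight is a nonnegative locally integrable function, positive a.e.; $\omega(E)=\int_E\omega$. Generalized local weighted Morrey space: $\|f\|_{M^{p,\varphi}_{x_0}(\omega)}:=\sup_{r>0}\varphi(x_0,r)^{-1}\omega(B(x_0,r))^{-1/p}\|f\|_{L^p(B(x_0,r),\omega dx)}$; the weak version $WM^{p,\varphi}_{x_0}(\omega)$ uses $\|f\|_{WL^p(B(x_0,r),\omega dx)}=\sup_{\alpha>0}\alpha\,\omega(\{y\in B(x_0,r):|f(y)|>\alpha\})^{1/p}$ instead. Multiple weights: $v_{\vec\omega}=\prod_i\omega_i^{p/p_i}$; $\vec\omega\in A_{\vec P}$ means $\sup_B(\frac1{|B|}\int_Bv_{\vec\omega})^{1/p}\prod_i(\frac1{|B|}\int_B\omega_i^{1-p_i'})^{1/p_i'}<\infty$ (for $p_i=1$ the factor is $(\inf_B\omega_i)^{-1}$). $A_\infty=\bigcup_{p\ge1}A_p$. For a ball $B$: $f_i^0=f_i\chi_{2B}$, $f_i^\infty=f_i\chi_{(2B)^c}$. $T\in LS(\prod_iX_i)$: there is $C$ such that for every ball $B$, $f_i\in X_i$, $(\alpha_1,\dots,\alpha_m)\in\{0,\infty\}^m$ not all $0$: $\|T(f_1^{\alpha_1},\dots,f_m^{\alpha_m})\|_{L^\infty(B)}\le C\sum_{j\ge1}\prod_i\frac1{|2^{j+1}B|}\int_{2^{j+1}B}|f_i|$. $T\in LB(\prod_iX_i\to Y)$: there is $C$ with $\|T(f_1^0,\dots,f_m^0)\|_Y\le C\prod_i\|f_i\|_{X_i}$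 for every ball $B$ and $f_i\in X_i$. *)

(* Defs.v *)
From HB Require Import structures.
From mathcomp Require Import all_boot all_order all_algebra.
From mathcomp Require Import all_classical all_reals all_analysis.
Set Implicit Arguments. Unset Strict Implicit. Unset Printing Implicit Defensive.
Import Order.TTheory GRing.Theory Num.Theory.
Import numFieldNormedType.Exports.
Local Open Scope classical_set_scope.
Local Open Scope ring_scope.

(* Points of R^n are n-tuples of reals; [n.-tuple R] carries the product
   (= Borel) sigma-algebra of MathComp-Analysis. *)

Definition eball (R : realType) (n : nat) (x : n.-tuple R) (r : R)
  : set (n.-tuple R) :=
  [set y | Num.sqrt (\sum_(i < n) (tnth y i - tnth x i) ^+ 2) < r].

(* mu is the n-dimensional Lebesgue measure (on Borel sets): it gives every
   half-open box its volume.  Such a measure exists and is unique. *)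
Definition is_lebesgue_measure (R : realType) (n : nat)
  (mu : {measure set (n.-tuple R) -> \bar R}) : Prop :=
  forall a b : n.-tuple R, (forall i, tnth a i <= tnth b i) ->
    mu [set x | forall i, tnth a i < tnth x i <= tnth b i]
    = (\prod_(i < n) (tnth b i - tnth a i))%:E.

Section defs.
Context (R : realType) (n : nat) (mu : {measure set (n.-tuple R) -> \bar R}).
Local Notation pt := (n.-tuple R).

Definition wmeas (w : pt -> R) (E : set pt) : \bar R :=
  (\int[mu]_(y in E) (w y)%:E)%E.

Definition is_weight (w : pt -> R) : Prop :=
  [/\ measurable_fun setT w,
      (forall x, 0 <= w x),
      (forall x r, 0 < r -> mu.-integrable (eball x r) (fun y => (w y)%:E))
    & {ae mu, forall x, 0 < w x}].

Definition avg (B : set pt) (g : pt -> R) : \bar R :=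
  (((fine (mu B))^-1)%:E * \int[mu]_(y in B) (g y)%:E)%E.

Definition ess_sup_on (B : set pt) (g : pt -> R) : \bar R :=
  ereal_inf [set a : \bar R | mu.-negligible [set x | B x /\ (a < (g x)%:E)%E]].
Definition ess_inf_on (B : set pt) (g : pt -> R) : \bar R :=
  ereal_sup [set a : \bar R | mu.-negligible [set x | B x /\ ((g x)%:E < a)%E]].

Definition A_p (p : R) (w : pt -> R) : Prop :=
  [/\ 1 <= p,
     (p = 1 -> exists C : R, forall x r, 0 < r ->
        (avg (eball x r) w <= C%:E * ess_inf_on (eball x r) w)%E)
   & (1 < p -> exists C : R, forall x r, 0 < r ->
        (avg (eball x r) w *
         poweR (avg (eball x r) (fun y => powR (w y) (- (p - 1)^-1))) (p - 1)
         <= C%:E)%E)].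

Definition A_infty (w : pt -> R) : Prop := exists p : R, A_p p w.

Definition exp_p (m : nat) (pk : 'I_m -> R) : R := (\sum_(i < m) (pk i)^-1)^-1.

Definition v_omega (m : nat) (pk : 'I_m -> R) (w : 'I_m -> pt -> R) : pt -> R :=
  fun y => \prod_(i < m) powR (w i y) (exp_p pk / pk i).

Definition A_vec (m : nat) (pk : 'I_m -> R) (w : 'I_m -> pt -> R) : Prop :=
  exists C : R, forall x r, 0 < r ->
    (poweR (avg (eball x r) (v_omega pk w)) (exp_p pk)^-1 *
     \big[*%E/1%E]_(i < m)
        (if pk i == 1%R then (ess_inf_on (eball x r) (w i))^-1
         else poweR (avg (eball x r)
                        (fun y => powR (w i y) (1 - pk i / (pk i - 1))))
                    (pk i / (pk i - 1))^-1)
     <= C%:E)%E.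

Definition Lp_w (p : R) (w : pt -> R) (B : set pt) (f : pt -> R) : \bar R :=
  poweR (\int[mu]_(y in B) (powR `|f y| p * w y)%:E)%E p^-1.

Definition WLp_w (p : R) (w : pt -> R) (B : set pt) (f : pt -> R) : \bar R :=
  ereal_sup [set (alpha * powR (fine (wmeas w [set y | B y /\ alpha < `|f y|])) p^-1)%:E
            | alpha in `]0, +oo[%classic].

Definition morrey_norm (p : R) (phi : pt -> R -> R) (w : pt -> R) (x0 : pt)
  (f : pt -> R) : \bar R :=
  ereal_sup [set (((phi x0 r)^-1 * powR (fine (wmeas w (eball x0 r))) (- p^-1))%:E
                  * Lp_w p w (eball x0 r) f)%E | r in `]0, +oo[%classic].

Definition weak_morrey_norm (p : R) (phi : pt -> R -> R) (w : pt -> R) (x0 : pt)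
  (f : pt -> R) : \bar R :=
  ereal_sup [set (((phi x0 r)^-1 * powR (fine (wmeas w (eball x0 r))) (- p^-1))%:E
                  * WLp_w p w (eball x0 r) f)%E | r in `]0, +oo[%classic].

Definition in_morrey p phi w x0 (f : pt -> R) : Prop :=
  measurable_fun setT f /\ (morrey_norm p phi w x0 f < +oo)%E.

Definition in_weak_morrey p phi w x0 (f : pt -> R) : Prop :=
  measurable_fun setT f /\ (weak_morrey_norm p phi w x0 f < +oo)%E.

End defs.

Definition ess_inf_gt (R : realType) (t : R) (g : R -> R) : \bar R :=
  ereal_sup [set a : \bar R |
    (@lebesgue_measure R).-negligible [set eta | t < eta /\ ((g eta)%:E < a)%E]].

Definition cut_in (R : realType) (n : nat) (x : n.-tuple R) (r : R)
  (g : n.-tuple R -> R) : n.-tuple R -> R :=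
  fun y => g y * \1_(eball x (2 * r)) y.
Definition cut_out (R : realType) (n : nat) (x : n.-tuple R) (r : R)
  (g : n.-tuple R -> R) : n.-tuple R -> R :=
  fun y => g y * \1_(~` eball x (2 * r)) y.

(* Main.v *)
Require Import Defs.
From HB Require Import structures.
From mathcomp Require Import all_boot all_order all_algebra.
From mathcomp Require Import all_classical all_reals all_analysis.
From mathcomp Require Import measurable_realfun ess_sup_inf zify ring lra.
Set Implicit Arguments.
Unset Strict Implicit.
Unset Printing Implicit Defensive.
Import Order.TTheory GRing.Theory Num.Theory.
Import numFieldNormedType.Exports.
Local Open Scope classical_set_scope.
Local Open Scope ring_scope.

(** Split every f_i as f_i chi_{2B} + f_i chi_{(2B)^c} with B = B(x0, r); by
    sublinearity |T f| is at most a sum of 2^m terms.  The purely local term is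
    controlled by LB.  For the others, LS reduces the matter to bounding
    sum_j prod_i avg_{2^{j+1}B} |f_i| by a multiple of phi_2(x0, r).

    Hoelder's inequality and the A_P condition bound prod_i avg_B |f_i| by the
    weighted L^{p_i} norms, up to prod_i (avg_B w_i)^{1/p_i} / (avg_B v_omega)^{1/p},
    which is bounded because every w_i is in A_infty (a reverse Jensen inequality).
    The dyadic sum is then a lower Riemann sum of the integral in the hypothesis
    on (phi_1, phi_2).  The argument gives the strong bound for every p_k >= 1; the
    weak one follows by Chebyshev. *)

(** The exponent [exp_p pk] may be smaller than 1, where L^p has no triangle inequality. The pieces
    of T f are therefore added as integrals of |.|^p, at a cost of 2 * 2^p per split coordinate, and
    the root is taken once they are summed. The reverse Jensen inequality avoids the geometric mean
    exp(avg log w): A_infty controls the average of some negative power w^(-s), and the tangent-line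
    inequalities e^x >= 1 + x and ln z <= z - 1 bound [v_omega] below, up to a scalar, by an affine
    expression in the w_i^(-s_i), which is integrated after all terms are made nonnegative. The
    integrand of the condition on (phi_1, phi_2) contains an essential infimum whose measurability
    in t is not established; it is compared with step functions lying below it. The product of the
    Morrey norms may be 0, so the estimates carry a strictly positive majorant N of it, which is
    brought down to it at the end. *)

Section balls.
Context (R : realType) (n : nat).
Implicit Types (x y : n.-tuple R) (r s : R).

Lemma measurable_eball x r : measurable (eball x r).
Proof.
have -> : eball x r = (fun y : n.-tuple R =>
    Num.sqrt (\sum_(i < n) (tnth y i - tnth x i) ^+ 2)) @^-1` [set s | s < r].
  by [].
rewrite -[X in measurable X]setTI.
have msum : measurable_fun setT
    (fun y : n.-tuple R => \sum_(i < n) (tnth y i - tnth x i) ^+ 2).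
  apply: measurable_sum => i; apply: measurable_funX.
  by apply: measurable_funB => //; exact: measurable_tnth.
have -> : (fun y : n.-tuple R =>
    Num.sqrt (\sum_(i < n) (tnth y i - tnth x i) ^+ 2)) =
    (@powR R ^~ 2^-1) \o (fun y => \sum_(i < n) (tnth y i - tnth x i) ^+ 2).
  by apply/funext => y /=; rewrite powR12_sqrt// sumr_ge0// => i _; exact: sqr_ge0.
have mf := measurableT_comp (measurable_powR (2^-1 : R)) msum.
apply: mf => //.
have -> : [set s | s < r] = `]-oo, r[%classic :> set R.
  by apply/seteqP; split=> s /=; rewrite in_itv.
exact: measurable_itv.
Qed.

Lemma eball_dist x r y i : eball x r y -> `|tnth y i - tnth x i| < r.
Proof.
rewrite /eball /=; apply: le_lt_trans; rewrite -sqrtr_sqr ler_wsqrtr//.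
by rewrite (bigD1 i)//= lerDl sumr_ge0// => j _; exact: sqr_ge0.
Qed.

Lemma subset_eball x r s : r <= s -> eball x r `<=` eball x s.
Proof. by move=> rs y /= /lt_le_trans; apply. Qed.

Variable mu : {measure set (n.-tuple R) -> \bar R}.
Hypothesis Hmu : is_lebesgue_measure mu.

Lemma measurable_cube (a b : n.-tuple R) :
  measurable [set x | forall i, tnth a i < tnth x i <= tnth b i].
Proof.
have -> : [set x : n.-tuple R | forall i, tnth a i < tnth x i <= tnth b i] =
    \bigcap_(i in [set: 'I_n])
      ((fun x : n.-tuple R => tnth x i) @^-1` `]tnth a i, tnth b i]).
  apply/seteqP; split => x /= h i; first by move=> _ /=; rewrite in_itv/=.
  by have /= := h i I; rewrite in_itv.
apply: fin_bigcap_measurable => [|i _]; first exact: finite_finset.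
rewrite -[X in measurable X]setTI.
exact: (@measurable_tnth _ _ n i).
Qed.

(** The hypothesis on [mu] speaks of boxes only, so a ball is measured through its circumscribed
    cube of half side r. *)
Lemma mu_eball_le x r : 0 < r -> (mu (eball x r) <= ((2 * r) ^+ n)%:E)%E.
Proof.
move=> r0; pose a := [tuple tnth x i - r | i < n].
pose b := [tuple tnth x i + r | i < n].
have ab i : tnth a i <= tnth b i by rewrite !tnth_mktuple; lra.
apply: (@le_trans _ _ (mu [set x | forall i, tnth a i < tnth x i <= tnth b i])).
  apply: le_measure; rewrite ?inE; [exact: measurable_eball|exact: measurable_cube|].
  move=> y xy i; have := eball_dist i xy.
  by rewrite !tnth_mktuple ltr_norml => /andP[]; lra.
rewrite Hmu// lee_fin (eq_bigr (fun=> 2 * r)).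
  by rewrite prodr_const card_ord.
by move=> i _; rewrite !tnth_mktuple; ring.
Qed.

(* The cube of half side r/(n+1) sits inside the ball of radius r. *)
Lemma mu_eball_ge x r : 0 < r -> (((2 * (r / n.+1%:R)) ^+ n)%:E <= mu (eball x r))%E.
Proof.
move=> r0; set s := r / n.+1%:R.
have s0 : 0 < s by rewrite divr_gt0.
have rE : r = n.+1%:R * s by rewrite /s mulrCA divff ?mulr1// pnatr_eq0.
pose a := [tuple tnth x i - s | i < n].
pose b := [tuple tnth x i + s | i < n].
have ab i : tnth a i <= tnth b i by rewrite !tnth_mktuple; lra.
apply: (@le_trans _ _ (mu [set x | forall i, tnth a i < tnth x i <= tnth b i])).
  rewrite Hmu// lee_fin (eq_bigr (fun=> 2 * s)).
    by rewrite prodr_const card_ord.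
  by move=> i _; rewrite !tnth_mktuple; ring.
apply: le_measure; rewrite ?inE; [exact: measurable_cube|exact: measurable_eball|].
move=> y h; rewrite /eball /= -[ltRHS]ger0_norm ?(ltW r0)// -sqrtr_sqr.
rewrite ltr_sqrt ?exprn_gt0//.
apply: (@le_lt_trans _ _ (\sum_(i < n) s ^+ 2)).
  apply: ler_sum => i _; rewrite -[leLHS]real_normK ?num_real//.
  rewrite lerXn2r ?nnegrE ?(ltW s0)// ler_norml.
  by have := h i; rewrite !tnth_mktuple => /andP[]; lra.
(* Here n s^2 is compared with r^2 = (n+1)^2 s^2; the choice s = r/(n+1) makes the inequality
   strict, also for n = 0. *)
rewrite sumr_const card_ord -[X in X < _]mulr_natl rE [ltRHS]exprMn ltr_pM2r ?exprn_gt0//.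
rewrite expr2 -natrM ltr_nat; lia.
Qed.

Lemma mu_eball_gt0 x r : 0 < r -> (0 < mu (eball x r))%E.
Proof.
move=> r0; apply: lt_le_trans (mu_eball_ge _ r0).
by rewrite lte_fin exprn_gt0// mulr_gt0// divr_gt0.
Qed.

Lemma mu_eball_fin x r : 0 < r -> mu (eball x r) \is a fin_num.
Proof.
by move=> r0; rewrite ge0_fin_numE//; apply: le_lt_trans (mu_eball_le _ r0) _; rewrite ltry.
Qed.

Lemma fine_mu_eball_gt0 x r : 0 < r -> 0 < fine (mu (eball x r)).
Proof.
by move=> r0; rewrite fine_gt0// mu_eball_gt0//= ltey_eq mu_eball_fin.
Qed.

(** Quotient of the two cube bounds: s <= 2 r gives 2 s <= 4 r = 2 (n+1) times the side 2 r/(n+1) of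
    the inscribed cube. *)
Lemma mu_eball_doubling x r s : 0 < r -> 0 < s -> s <= 2 * r ->
  fine (mu (eball x s)) <= (2 * n.+1%:R) ^+ n * fine (mu (eball x r)).
Proof.
move=> r0 s0 sr; apply: (@le_trans _ _ ((2 * s) ^+ n)).
  by rewrite -lee_fin fineK ?mu_eball_fin// mu_eball_le.
apply: (@le_trans _ _ ((2 * n.+1%:R) ^+ n * (2 * (r / n.+1%:R)) ^+ n)); last first.
  rewrite ler_wpM2l ?exprn_ge0// -lee_fin fineK ?mu_eball_fin//.
  exact: mu_eball_ge.
rewrite -exprMn lerXn2r ?nnegrE ?mulr_ge0// ?(ltW s0)// ?divr_ge0// ?(ltW r0)//.
have -> : 2 * n.+1%:R * (2 * (r / n.+1%:R)) = 4 * r :> R.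
  have : n.+1%:R != 0 :> R by rewrite pnatr_eq0.
  by move: (n.+1%:R : R) => N N0; field.
by lra.
Qed.

End balls.

Lemma conjugate_exponent (R : realType) (p : R) : 1 < p ->
  p^-1 + (p / (p - 1))^-1 = 1.
Proof. by move=> p1; rewrite invf_div; field; lra. Qed.

(** * Essential bounds, averages and Hoelder's inequality on a set *)

Section weighted_averages.
Context (R : realType) (n : nat) (mu : {measure set (n.-tuple R) -> \bar R}).
Local Notation pt := (n.-tuple R).
Implicit Types (B : set pt) (f g w : pt -> R) (p : R).

(** The value +oo off B cannot affect an infimum, so the general facts on [ess_inf] transfer to the
    version restricted to B. *)
Lemma ess_inf_onE B g :
  ess_inf_on mu B g = ess_inf mu (fun x => if x \in B then (g x)%:E else +oo%E).
Proof.
congr ereal_sup; apply/seteqP; split=> a /= h;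
  (apply: (negligibleS _ h) => x /=; case: ifPn => xB).
- by move/negP; rewrite -ltNge => ?; split=> //; exact/set_mem.
- by rewrite leey.
- by move=> [_]; rewrite ltNge => /negP.
- by move=> [/mem_set]; rewrite (negbTE xB).
Qed.

Lemma ess_inf_on_le B g :
  {ae mu, forall x, B x -> (ess_inf_on mu B g <= (g x)%:E)%E}.
Proof.
have := ess_inf_le mu (fun x => if x \in B then (g x)%:E else +oo%E).
by rewrite -ess_inf_onE; apply: filterS => x /= + /mem_set xB; rewrite xB.
Qed.

Lemma ess_sup_onE B g :
  ess_sup_on mu B g = ess_sup mu (fun x => if x \in B then (g x)%:E else -oo%E).
Proof.
congr ereal_inf; apply/seteqP; split=> a /= h;
  (apply: (negligibleS _ h) => x /=; case: ifPn => xB).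
- by move/negP; rewrite -ltNge => ?; split=> //; exact/set_mem.
- by rewrite leNye.
- by move=> [_]; rewrite ltNge => /negP.
- by move=> [/mem_set]; rewrite (negbTE xB).
Qed.

Lemma ess_sup_on_ge B g :
  {ae mu, forall x, B x -> ((g x)%:E <= ess_sup_on mu B g)%E}.
Proof.
have := ess_sup_ge mu (fun x => if x \in B then (g x)%:E else -oo%E).
by rewrite -ess_sup_onE; apply: filterS => x /= + /mem_set xB; rewrite xB.
Qed.

Lemma ae_exists B (P : pt -> Prop) : measurable B -> (0 < mu B)%E ->
  {ae mu, forall x, B x -> P x} -> exists2 x, B x & P x.
Proof.
move=> mB B0 [N [mN N0 PN]]; apply: contrapT => h.
suff : (mu B <= mu N)%E by rewrite N0 leNgt B0.
apply: le_measure; rewrite ?inE// => x Bx.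
by apply: PN => /= /(_ Bx) Px; apply: h; exists x.
Qed.

Lemma integral_gt0_ae B g : measurable B -> (0 < mu B)%E ->
  measurable_fun setT g -> (forall x, 0 <= g x) ->
  {ae mu, forall x, B x -> 0 < g x} -> (0 < \int[mu]_(x in B) (g x)%:E)%E.
Proof.
move=> mB B0 mg g0 gae; rewrite lt0e; apply/andP; split; last first.
  by apply: integral_ge0 => x _; rewrite lee_fin.
apply/eqP => I0.
have mgB : measurable_fun B (EFin \o g).
  by apply/measurable_EFinP; exact: measurable_funTS.
have : (\int[mu]_(x in B) `|(EFin \o g) x| = 0)%E.
  by rewrite -[RHS]I0; apply: eq_integral => x _ /=; rewrite ger0_norm.
move=> /(ae_eq_integral_abs mu mB mgB) gz.
have [x Bx []] : exists2 x, B x & 0 < g x /\ g x = 0.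
  apply: (ae_exists mB B0); move: gae gz; rewrite /ae_eq.
  by apply: filterS2 => x + + Bx => /(_ Bx) ? /(_ Bx) /= [].
by move=> + gx0; rewrite gx0 ltxx.
Qed.

Lemma ess_inf_on_ge0 B g : (forall x, 0 <= g x) -> (0 <= ess_inf_on mu B g)%E.
Proof.
move=> g0; apply: ereal_sup_ubound => /=.
rewrite (_ : [set x | _] = set0); first exact: negligible_set0.
by apply/seteqP; split=> // x /= [_]; rewrite lte_fin ltNge g0.
Qed.

Lemma ess_inf_on_lty B g : measurable B -> (0 < mu B)%E ->
  (ess_inf_on mu B g < +oo)%E.
Proof.
move=> mB B0; have [x _ /le_lt_trans] := ae_exists mB B0 (ess_inf_on_le B g).
by apply; rewrite ltry.
Qed.

(** The factor of a single weight in [A_vec], convertible to the expression there. *)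
Definition dual_avg p w B : \bar R :=
  (if p == 1%R then (ess_inf_on mu B w)^-1
   else poweR (avg mu B (fun y => powR (w y) (1 - p / (p - 1))))
              (p / (p - 1))^-1)%E.

Lemma avg_ge0 B g : measurable B -> (forall x, 0 <= g x) -> (0 <= avg mu B g)%E.
Proof.
move=> mB g0; rewrite mule_ge0 ?lee_fin ?invr_ge0 ?fine_ge0//.
by apply: integral_ge0 => x _; rewrite lee_fin.
Qed.

Lemma Lp_w_ge0 p w B f : (0 <= Lp_w mu p w B f)%E.
Proof. exact: poweR_ge0. Qed.

(** Hoelder for |f| = (|f| w^(1/p)) w^(-1/p) with q = p/(p-1): the second factor to the power q is
    w^(1-q). The factorization needs w > 0, hence holds almost everywhere; indicators of B reduce to
    integrals over the whole space. *)
Lemma hoelder_on B p w f : measurable B -> 1 < p ->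
  measurable_fun setT w -> (forall x, 0 <= w x) -> {ae mu, forall x, 0 < w x} ->
  measurable_fun setT f ->
  (\int[mu]_(y in B) (`|f y|)%:E <= Lp_w mu p w B f *
   poweR (\int[mu]_(y in B) (powR (w y) (1 - p / (p - 1)))%:E) (p / (p - 1))^-1)%E.
Proof.
move=> mB p1 mw w0 wae mf; set q := p / (p - 1).
have p0 : 0 < p by lra.
have q0 : 0 < q by rewrite divr_gt0//; lra.
have pq : p^-1 + q^-1 = 1 by exact: conjugate_exponent.
pose F (x : pt) : R := `|f x| * powR (w x) p^-1 * \1_B x.
pose G (x : pt) : R := powR (w x) (- p^-1) * \1_B x.
have m1B : measurable_fun setT (\1_B : pt -> R) by exact: measurable_indic.
have mpw a : measurable_fun setT (fun x => powR (w x) a).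
  exact: (measurableT_comp (measurable_powR a) mw).
have mF : measurable_fun setT F.
  by do 2 apply: measurable_funM => //; exact: measurableT_comp.
have mG : measurable_fun setT G by exact: measurable_funM.
have := hoelder mu mF mG p0 q0 pq.
have -> : Lp_w mu p w B f = Lnorm mu p%:E (EFin \o F).
  rewrite unlock /Lp_w; congr poweR; rewrite [LHS]integral_mkcond.
  apply: eq_integral => x _; rewrite patchE /= /F indicE.
  case: ifPn => xB /=; last by rewrite mulr0 normr0 powR0 ?gt_eqF.
  rewrite mulr1 normrM normr_id (ger0_norm (powR_ge0 _ _)).
  rewrite powRM ?powR_ge0//.
  by rewrite -powRrM mulVf ?gt_eqF// powRr1.
have -> : poweR (\int[mu]_(y in B) (powR (w y) (1 - q))%:E) q^-1 =
    Lnorm mu q%:E (EFin \o G).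
  rewrite unlock; congr poweR; rewrite [LHS]integral_mkcond.
  apply: eq_integral => x _; rewrite patchE /= /G indicE.
  case: ifPn => xB /=; last by rewrite mulr0 normr0 powR0 ?gt_eqF.
  rewrite mulr1 ger0_norm ?powR_ge0// -powRrM; congr (_ `^ _)%:E.
  by rewrite /q; field; apply/andP; split; lra.
apply: le_trans; rewrite Lnorm1 [leLHS]integral_mkcond.
apply: ae_ge0_le_integral => //.
- by move=> x _; rewrite patchE; case: ifP => //; rewrite lee_fin.
- apply/(measurable_restrictT _ _).1 => //; apply/measurable_EFinP.
  by apply: measurable_funTS; exact: measurableT_comp.
- by apply: measurableT_comp => //; apply/measurable_EFinP; exact: measurable_funM.
apply: filterS wae => x wx _; rewrite patchE /= /F /G indicE.
case: ifPn => xB /=; last by rewrite lee_fin.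
rewrite lee_fin !mulr1 -mulrA -powRD ?(gt_eqF wx) ?implybT//.
by rewrite subrr powRr0 mulr1 normr_id.
Qed.

Lemma dual_avg_gt0 p w B : measurable B -> (0 < mu B < +oo)%E ->
  measurable_fun setT w -> (forall x, 0 <= w x) -> {ae mu, forall x, 0 < w x} ->
  (0 < dual_avg p w B)%E.
Proof.
move=> mB /andP[B0 Boo] mw w0 wae; rewrite /dual_avg; case: eqP => _.
  (* The inverse of 0 in the extended reals is +oo, so a zero essential infimum still gives a
     positive factor. *)
  have [->|e0] := eqVneq (ess_inf_on mu B w) 0%E; first by rewrite inve0.
  rewrite inve_gt0//; last by rewrite lt_eqF// ess_inf_on_lty.
  by rewrite lt0e e0 ess_inf_on_ge0.
apply: poweR_gt0; rewrite mule_gt0 ?lte_fin ?invr_gt0 ?fine_gt0 ?B0//.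
apply: integral_gt0_ae => //.
- exact: (measurableT_comp (measurable_powR _) mw).
- by move=> x; exact: powR_ge0.
- by apply: filterS wae => x wx _; exact: powR_gt0.
Qed.

Lemma avg_le_Lp B p w f : measurable B -> (0 < mu B < +oo)%E -> 1 <= p ->
  measurable_fun setT w -> (forall x, 0 <= w x) -> {ae mu, forall x, 0 < w x} ->
  measurable_fun setT f -> (dual_avg p w B < +oo)%E ->
  (avg mu B (fun y => `|f y|%R) <=
   (powR (fine (mu B)) (- p^-1))%:E * Lp_w mu p w B f * dual_avg p w B)%E.
Proof.
move=> mB /andP[B0 Boo] p1 mw w0 wae mf.
have b0 : 0 < fine (mu B) by rewrite fine_gt0 ?B0.
have mf' : measurable_fun B (fun x => (`|f x|)%:E).
  by apply/measurable_EFinP; apply: measurable_funTS; exact: measurableT_comp.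
rewrite /dual_avg; case: eqVneq => [->|pn1]; last first.
  move=> _; have {}p1 : 1 < p by rewrite lt_neqAle eq_sym pn1.
  set q := p / (p - 1); set I := (\int[mu]_(y in B) (powR (w y) (1 - q))%:E)%E.
  have I0 : (0 <= I)%E by apply: integral_ge0 => x _; rewrite lee_fin powR_ge0.
  rewrite {2}/avg -/I poweRM ?lee_fin ?invr_ge0 ?(ltW b0)//.
  (* 1/|B| = |B|^(-1/p) |B|^(-1/q): the first power is displayed in the statement, the second comes
     out of [dual_avg]. *)
  have -> : ((fine (mu B) `^ (- p^-1))%:E * Lp_w mu p w B f *
      (poweR (fine (mu B))^-1%:E q^-1 * poweR I q^-1))%E =
      ((fine (mu B))^-1%:E * (Lp_w mu p w B f * poweR I q^-1))%E.
    rewrite muleACA !muleA -EFinM; congr (_%:E * _ * _)%E.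
    have -> : (fine (mu B))^-1 `^ q^-1 = fine (mu B) `^ (- q^-1).
      by rewrite -[(fine _)^-1](powR_inv1 (ltW b0)) -powRrM mulN1r.
    rewrite -powRD ?(gt_eqF b0) ?implybT// -(powR_inv1 (ltW b0)).
    by rewrite -opprD conjugate_exponent.
  rewrite lee_pmul2l ?lte_fin ?invr_gt0//.
  exact: hoelder_on.
(* Case p = 1: with e the essential infimum of w, e |f| <= |f| w almost everywhere on B. The value e
   = 0 is excluded because [dual_avg] would be +oo. *)
have := ess_inf_on_ge0 B w0; have := ess_inf_on_lty w mB B0.
have := ess_inf_on_le B w.
case: ess_inf_on => // e ew _; rewrite lee_fin le_eqVlt => /predU1P[<-|e0 _].
  by rewrite inve0.
rewrite inver gt_eqF// invr1 powR_inv1 ?(ltW b0)// /avg -muleA.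
rewrite lee_pmul2l ?lte_fin ?invr_gt0// muleC.
rewrite lee_pdivlMl// /Lp_w invr1 poweRe1; last first.
  by apply: integral_ge0 => x _; rewrite lee_fin mulr_ge0// powR_ge0.
rewrite -ge0_integralZl_EFin ?(ltW e0)//.
apply: ae_ge0_le_integral => //.
- by move=> x _; rewrite -EFinM lee_fin mulr_ge0// ltW.
- by apply: measurable_funeM.
- by move=> x _; rewrite lee_fin mulr_ge0// powR_ge0.
- apply/measurable_EFinP; apply: measurable_funTS; apply: measurable_funM => //.
  by apply: (measurableT_comp (measurable_powR _)); exact: measurableT_comp.
apply: filterS ew => x /[apply]; rewrite !lee_fin powRr1// mulrC => ?.
by rewrite ler_wpM2l.
Qed.

End weighted_averages.

(** * Reverse Jensen inequality for A_infty weights *)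

Section reverse_jensen.
Context (R : realType).

Lemma powR_invl (x a : R) : 0 <= x -> x^-1 `^ a = (x `^ a)^-1.
Proof.
by move=> x0; rewrite -[x^-1]powR_inv1// powRAC powR_inv1 ?powR_ge0.
Qed.

(** The exponential lies above its tangent at 0, here evaluated at the sum of the th_i ln(u_i). *)
Lemma weighted_AM_GM_ln (m : nat) (th u : 'I_m -> R) : (forall i, 0 < u i) ->
  1 + \sum_(i < m) th i * ln (u i) <= \prod_(i < m) u i `^ th i.
Proof.
move=> u0.
have -> : \prod_(i < m) u i `^ th i = \prod_(i < m) expR (th i * ln (u i)).
  by apply: eq_bigr => i _; rewrite /powR gt_eqF.
by rewrite -expR_sum expR_ge1Dx.
Qed.

(** This is ln z <= z - 1 at z = w^(-s)/a, multiplied by -1/s < 0. The lower bound is affine in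
    w^(-s), the power whose average A_infty controls. *)
Lemma neg_powR_sub1_le_ln (s a w : R) : 0 < s -> 0 < a -> 0 < w ->
  - s^-1 * (w `^ (- s) / a - 1) <= ln (w / a `^ (- s^-1)).
Proof.
move=> s0 a0 w0.
have ws : 0 < w `^ (- s) by exact: powR_gt0.
have as0 : 0 < a `^ (- s^-1) by exact: powR_gt0.
rewrite ln_div ?posrE// ln_powR.
have := @le_ln1Dx R (w `^ (- s) / a - 1).
have -> : 1 + (w `^ (- s) / a - 1) = w `^ (- s) / a by rewrite addrC subrK.
rewrite ltrBrDr addNr divr_gt0// => /(_ isT).
rewrite ln_div ?posrE// ln_powR => h.
have -> : ln w - - s^-1 * ln a = - s^-1 * (- s * ln w - ln a).
  by field; rewrite gt_eqF.
by apply: ler_wnM2l h; rewrite oppr_le0 invr_ge0 ltW.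
Qed.

Context (n : nat) (mu : {measure set (n.-tuple R) -> \bar R}).
Hypothesis Hmu : is_lebesgue_measure mu.
Local Notation pt := (n.-tuple R).

Lemma mu_eball_bounds x r : 0 < r -> (0 < mu (eball x r) < +oo)%E.
Proof. by move=> r0; rewrite mu_eball_gt0//= ltey_eq mu_eball_fin. Qed.

Lemma avg_eball_le x r g (a : R) : 0 < r ->
  (avg mu (eball x r) g <= a%:E)%E =
  (\int[mu]_(y in eball x r) (g y)%:E <= (fine (mu (eball x r)) * a)%:E)%E.
Proof.
by move=> r0; rewrite /avg EFinM lee_pdivrMl// (fine_mu_eball_gt0 Hmu).
Qed.

Lemma weight_avg_fin w x r : is_weight mu w -> 0 < r ->
  avg mu (eball x r) w \is a fin_num.
Proof.
move=> [_ _ wi _] r0; rewrite fin_numM//.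
exact: (integrable_fin_num (measurable_eball x r) (wi _ _ r0)).
Qed.

Lemma weight_avg_gt0 w x r : is_weight mu w -> 0 < r ->
  (0 < avg mu (eball x r) w)%E.
Proof.
move=> [mw w0 wi wae] r0.
rewrite mule_gt0 ?lte_fin ?invr_gt0 ?(fine_mu_eball_gt0 Hmu)//.
apply: integral_gt0_ae => //; first exact: measurable_eball.
  exact: mu_eball_gt0.
by apply: filterS wae.
Qed.

(* Uniform form of the A_p condition for all p >= 1: for p > 1, a is the
   average of w^(-1/(p-1)); for p = 1, a is the inverse of the essential
   infimum of w. *)
Lemma A_infty_neg_power w : is_weight mu w -> A_infty mu w ->
  exists s K : R, [/\ 0 < s, 0 < K & forall x r, 0 < r ->
    exists a : R, [/\ 0 < a,
      (avg mu (eball x r) (fun y => powR (w y) (- s)) <= a%:E)%E &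
      fine (avg mu (eball x r) w) <= K * a `^ (- s^-1)]].
Proof.
move=> ww [p [p1 Ap1 Ap]]; have [mw w0 wi wae] := ww.
move: p1; rewrite le_eqVlt => /predU1P[/esym/Ap1{Ap1 Ap}[C HC]|p1].
  exists 1, (Num.max C 1); split=> //; first by rewrite lt_max ltr01 orbT.
  move=> x r r0; have := HC x r r0.
  have mB := measurable_eball x r.
  have B0 := mu_eball_gt0 Hmu x r0.
  have := ess_inf_on_ge0 mu (eball x r) w0.
  have := ess_inf_on_lty w mB B0.
  have := ess_inf_on_le mu (eball x r) w.
  case: ess_inf_on => // e ew _; rewrite lee_fin le_eqVlt => /predU1P[<-|e0].
    (* A zero essential infimum would force the average of w to be nonpositive. *)
    by rewrite mule0 leNgt weight_avg_gt0.
  rewrite -EFinM => wC; exists e^-1; split; first by rewrite invr_gt0.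
    rewrite avg_eball_le//.
    apply: (@le_trans _ _ (\int[mu]_(y in eball x r) (cst (e^-1)%:E y))%E).
      apply: ae_ge0_le_integral => //.
      - by move=> y _; rewrite lee_fin powR_ge0.
      - apply/measurable_EFinP; apply: measurable_funTS.
        exact: (measurableT_comp (measurable_powR _)).
      - by move=> y _; rewrite lee_fin invr_ge0 ltW.
      apply: filterS2 ew wae => y + wy By => /(_ By); rewrite !lee_fin => ewy.
      by rewrite powR_inv1 ?(ltW wy)// lef_pV2 ?posrE.
    rewrite integral_cst// -[mu _]fineK ?mu_eball_fin// -EFinM mulrC.
    by rewrite fineK ?mu_eball_fin.
  rewrite invr1 powR_inv1 ?invr_ge0 ?(ltW e0)// invrK.
  apply: (@le_trans _ _ (C * e)).
    by rewrite -lee_fin fineK ?weight_avg_fin.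
  by rewrite ler_pM2r// le_max lexx.
(* With this s the A_p product is avg(w) A^(1/s), where A is the average of w^(-s); hence a = A
   works once A is finite. *)
have [C HC] := Ap p1; pose s := (p - 1)^-1.
have s0 : 0 < s by rewrite invr_gt0 subr_gt0.
exists s, (Num.max C 1); split=> //; first by rewrite lt_max ltr01 orbT.
move=> x r r0; have := HC x r r0.
have mB := measurable_eball x r.
have B0 := mu_eball_gt0 Hmu x r0.
rewrite -/s; set A := avg mu _ (fun y => powR _ _).
have A0 : (0 < A)%E.
  rewrite mule_gt0 ?lte_fin ?invr_gt0 ?(fine_mu_eball_gt0 Hmu)//.
  apply: integral_gt0_ae => //.
  - exact: (measurableT_comp (measurable_powR _)).
  - by move=> y; exact: powR_ge0.
  - by apply: filterS wae => y wy _; exact: powR_gt0.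
have p10 : p - 1 != 0 by rewrite gt_eqF// subr_gt0.
have W0 := weight_avg_gt0 x ww r0.
(* A = +oo would make the A_p product infinite, since avg(w) > 0. *)
move: A0; case: A => [a| |]//; last first.
  by rewrite poweRyr// gt0_muley.
rewrite lte_fin => a0; rewrite -[X in (X * _)%E](fineK (weight_avg_fin x ww r0)).
rewrite poweR_EFin -EFinM lee_fin => wC.
exists a; split=> //; rewrite powRN ler_pdivlMr ?powR_gt0// /s invrK.
by rewrite (le_trans wC)// le_max lexx.
Qed.

(** With s_i, a_i from [A_infty_neg_power], put u_i = w_i / a_i^(-1/s_i); then [v_omega] is c times
    the product of the u_i^(th_i). The tangent-line inequalities bound this product below by 1 plus
    a positive combination of the 1 - w_i^(-s_i)/a_i, whose averages are nonnegative. Hence c <=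
    avg(v_omega), while c dominates the left side up to the product of the K_i^(th_i). *)
Lemma prod_avg_le_avg_v_omega (m : nat) (pk : 'I_m -> R) (w : 'I_m -> pt -> R) :
  (0 < m)%N -> (forall i, 1 <= pk i) ->
  (forall i, is_weight mu (w i)) -> (forall i, A_infty mu (w i)) ->
  exists2 K : R, 0 < K & forall x r, 0 < r ->
    ((\prod_(i < m) fine (avg mu (eball x r) (w i)) `^ (exp_p pk / pk i))%:E <=
     K%:E * avg mu (eball x r) (v_omega pk w))%E.
Proof.
move=> m0 pk1 ww wA.
have pk0 i : 0 < pk i by exact: lt_le_trans (pk1 i).
have p0 : 0 < exp_p pk.
  rewrite invr_gt0 (bigD1 (Ordinal m0))//= ltr_pwDl ?invr_gt0//.
  by apply: sumr_ge0 => i _; rewrite invr_ge0 ltW.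
pose th i := exp_p pk / pk i.
have th0 i : 0 < th i by rewrite divr_gt0.
have /choice[s] := fun i => A_infty_neg_power (ww i) (wA i).
move=> /choice[K sK].
exists (\prod_(i < m) K i `^ th i).
  by apply: prodr_gt0 => i _; apply: powR_gt0; have [] := sK i.
move=> x r r0.
have /choice[a Ha] : forall i, exists a : R, [/\ 0 < a,
      (avg mu (eball x r) (fun y => powR (w i y) (- s i)) <= a%:E)%E &
      fine (avg mu (eball x r) (w i)) <= K i * a `^ (- (s i)^-1)].
  by move=> i; have [_ _] := sK i; exact.
have s0 i : 0 < s i by have [] := sK i.
have K0 i : 0 < K i by have [] := sK i.
have a0 i : 0 < a i by have [] := Ha i.
pose c := \prod_(i < m) (a i `^ (- (s i)^-1)) `^ th i.
have c0 : 0 < c by apply: prodr_gt0 => i _; do 2 apply: powR_gt0.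
apply: (@le_trans _ _ ((\prod_(i < m) K i `^ th i) * c)%:E).
  rewrite lee_fin /c -big_split/=; apply: ler_prod => i _.
  rewrite powR_ge0/= -powRM ?(ltW (K0 i)) ?powR_ge0//.
  apply: ge0_ler_powR; rewrite ?nnegrE ?(ltW (th0 i))//.
  - by rewrite fine_ge0// ltW// weight_avg_gt0.
  - by rewrite mulr_ge0 ?powR_ge0// ltW.
  - by have [] := Ha i.
have mB := measurable_eball x r.
set b := fine (mu (eball x r)).
have b0 : 0 < b by exact: fine_mu_eball_gt0.
pose k i := th i / s i / a i.
have k0 i : 0 <= k i by rewrite !divr_ge0// ltW.
pose S := \sum_(i < m) th i / s i.
(* The terms in w_i^(-s_i) are moved next to [v_omega], so that both sides are nonnegative and can
   be integrated as they stand. *)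
have ptw : {ae mu, forall y, (1 + S <=
    c^-1 * v_omega pk w y + \sum_(i < m) k i * w i y `^ (- s i))}.
  have wae : {ae mu, forall y, forall i, 0 < w i y}.
    by apply: filter_forall => i; have [] := ww i.
  apply: filterS wae => y wy.
  have -> : c^-1 * v_omega pk w y =
      \prod_(i < m) (w i y / a i `^ (- (s i)^-1)) `^ th i.
    rewrite /v_omega mulrC /c -prodf_div; apply: eq_bigr => i _.
    rewrite powRM ?(ltW (wy i)) ?invr_ge0 ?powR_ge0//; congr (_ * _).
    by rewrite powR_invl ?powR_ge0.
  rewrite -lerBlDr; apply: le_trans (weighted_AM_GM_ln th _); last first.
    by move=> i; rewrite divr_gt0 ?powR_gt0.
  rewrite -addrA lerD2l /S -sumrB; apply: ler_sum => i _.
  apply: le_trans (ler_wpM2l (ltW (th0 i)) (neg_powR_sub1_le_ln (s0 i) (a0 i) (wy i))).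
  rewrite /k le_eqVlt; apply/orP; left; apply/eqP.
  by field; rewrite !gt_eqF.
have mv : measurable_fun setT (v_omega pk w).
  apply: measurable_prod => i _.
  by apply: (measurableT_comp (measurable_powR _)); have [] := ww i.
have v0 y : 0 <= v_omega pk w y by apply: prodr_ge0 => i _; exact: powR_ge0.
have mws i : measurable_fun (eball x r) (fun y => (w i y `^ (- s i))%:E).
  apply/measurable_EFinP; apply: measurable_funTS.
  by apply: (measurableT_comp (measurable_powR _)); have [] := ww i.
have mvB : measurable_fun (eball x r) (fun y => (v_omega pk w y)%:E).
  by apply/measurable_EFinP; exact: measurable_funTS.
have key : (b%:E <= c^-1%:E * \int[mu]_(y in eball x r) (v_omega pk w y)%:E)%E.
  have S0 : 0 <= S by apply: sumr_ge0 => i _; rewrite divr_ge0// ltW.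
  have int : ((b * (1 + S))%:E <=
      c^-1%:E * \int[mu]_(y in eball x r) (v_omega pk w y)%:E +
      \sum_(i < m) (k i)%:E * \int[mu]_(y in eball x r) (w i y `^ (- s i))%:E)%E.
    rewrite -ge0_integralZl_EFin ?invr_ge0 ?(ltW c0)//; last first.
      by move=> y _; rewrite lee_fin.
    under eq_bigr => i _.
      rewrite -ge0_integralZl_EFin//; last by move=> y _; rewrite lee_fin powR_ge0.
      over.
    rewrite -ge0_integral_sum//; last 2 first.
    - by move=> i; exact: measurable_funeM.
    - by move=> i y _; rewrite mule_ge0// lee_fin ?powR_ge0.
    rewrite -ge0_integralD//; last 4 first.
    - by move=> y _; rewrite mule_ge0 ?lee_fin ?invr_ge0 ?(ltW c0).
    - exact: measurable_funeM.
    - by move=> y _; apply: sume_ge0 => i _; rewrite mule_ge0// lee_fin ?powR_ge0.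
    - by apply: emeasurable_sum => i; exact: measurable_funeM.
    apply: (@le_trans _ _ (\int[mu]_(y in eball x r) (cst (1 + S)%:E y))%E).
      by rewrite integral_cst// -[mu _]fineK ?mu_eball_fin// -EFinM mulrC.
    apply: ae_ge0_le_integral => //.
    - by move=> y _; rewrite lee_fin addr_ge0.
    - move=> y _; apply: adde_ge0; last apply: sume_ge0 => i _.
        by rewrite mule_ge0 ?lee_fin ?invr_ge0 ?(ltW c0).
      by rewrite mule_ge0// lee_fin ?powR_ge0.
    - apply: emeasurable_funD; first exact: measurable_funeM.
      by apply: emeasurable_sum => i; exact: measurable_funeM.
    apply: filterS ptw => y + _.
    rewrite (eq_bigr (fun i => (k i * w i y `^ (- s i))%:E))// => h.
    by rewrite sumEFin -EFinM -EFinD lee_fin.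
  (* As k_i a_i = th_i/s_i, these integrals add up to at most b S, the surplus on the left of [int];
     it is a real number and cancels. *)
  have : (\sum_(i < m) (k i)%:E * \int[mu]_(y in eball x r) (w i y `^ (- s i))%:E
      <= (b * S)%:E)%E.
    rewrite /S mulr_sumr -sumEFin; apply: lee_sum => i _.
    have [_ + _] := Ha i; rewrite avg_eball_le// -/b => h.
    apply: le_trans (lee_wpmul2l _ h) _; first by rewrite lee_fin.
    rewrite -EFinM lee_fin /k le_eqVlt; apply/orP; left; apply/eqP.
    by field; rewrite !gt_eqF.
  move=> /(leeD2l (c^-1%:E * \int[mu]_(y in eball x r) (v_omega pk w y)%:E)%E).
  move=> /(le_trans int).
  by rewrite mulrDr mulr1 EFinD leeD2rE.
rewrite EFinM; apply: lee_wpmul2l.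
  by rewrite lee_fin; apply: prodr_ge0 => i _; exact: powR_ge0.
by rewrite /avg -/b lee_pdivlMl// -EFinM mulrC EFinM -lee_pdivlMl.
Qed.

End reverse_jensen.

(** * Finite products of extended reals *)

Section extended_products.
Context (R : realType) (I : Type).
Implicit Types (s : seq I) (P : pred I) (F G : I -> \bar R).

Lemma lee_prod s P F G : (forall i, P i -> (0 <= F i <= G i)%E) ->
  (\big[*%E/1%E]_(i <- s | P i) F i <= \big[*%E/1%E]_(i <- s | P i) G i)%E.
Proof.
move=> FG; have : (0 <= \big[*%E/1%E]_(i <- s | P i) F i <=
    \big[*%E/1%E]_(i <- s | P i) G i)%E.
  elim/big_ind2 : _ => [|a b c d /andP[a0 ab] /andP[c0 cd]|//].
    by rewrite lexx lee_fin ler01.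
  by rewrite mule_ge0//= lee_pmul.
by case/andP.
Qed.

Lemma prode_gt0 s P F : (forall i, P i -> (0 < F i)%E) ->
  (0 < \big[*%E/1%E]_(i <- s | P i) F i)%E.
Proof.
by move=> F0; elim/big_ind : _ => //; exact: mule_gt0.
Qed.

End extended_products.

(** Positivity matters: since 0 times +oo is 0, a vanishing factor could hide an infinite one. *)
Lemma prode_lty_inv (R : realType) (I : finType) (F : I -> \bar R) :
  (forall i, (0 < F i)%E) -> (\big[*%E/1%E]_(i : I) F i < +oo)%E ->
  forall i, (F i < +oo)%E.
Proof.
move=> F0 + i; rewrite (bigD1 i)//=; have := F0 i; case: (F i) => // [x|].
  by rewrite ltry.
by rewrite gt0_mulye//; exact: prode_gt0.
Qed.

Lemma powR_prod (R : realType) (I : Type) (s : seq I) (P : pred I)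
    (F : I -> R) (a : R) : (forall i, P i -> 0 <= F i) ->
  (\prod_(i <- s | P i) F i) `^ a = \prod_(i <- s | P i) F i `^ a.
Proof.
move=> F0; elim: s => [|i s IH]; first by rewrite !big_nil powR1.
rewrite !big_cons; case: ifPn => // Pi.
by rewrite powRM ?F0 ?prodr_ge0// IH.
Qed.

(** * Products of averages on one ball *)

Section prod_avg.
Context (R : realType) (n : nat) (mu : {measure set (n.-tuple R) -> \bar R}).
Hypothesis Hmu : is_lebesgue_measure mu.
Local Notation pt := (n.-tuple R).
Context (m : nat) (pk : 'I_m -> R) (w : 'I_m -> pt -> R).
Hypotheses (m0 : (0 < m)%N) (pk1 : forall i, 1 <= pk i).
Hypotheses (ww : forall i, is_weight mu (w i)).

Lemma pk_gt0 i : 0 < pk i.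
Proof. exact: lt_le_trans (pk1 i). Qed.

Lemma exp_p_gt0 : 0 < exp_p pk.
Proof.
rewrite invr_gt0 (bigD1 (Ordinal m0))//= ltr_pwDl ?invr_gt0 ?pk_gt0//.
by apply: sumr_ge0 => i _; rewrite invr_ge0 ltW ?pk_gt0.
Qed.

Lemma wmeas_eball_fin i x r : 0 < r -> wmeas mu (w i) (eball x r) \is a fin_num.
Proof.
move=> r0; have [_ _ wi _] := ww i.
exact: (integrable_fin_num (measurable_eball x r) (wi _ _ r0)).
Qed.

Lemma wmeas_eball_gt0 i x r : 0 < r -> (0 < wmeas mu (w i) (eball x r))%E.
Proof.
move=> r0; have [mw w0 wi wae] := ww i.
apply: integral_gt0_ae => //; first exact: measurable_eball.
  exact: mu_eball_gt0.
by apply: filterS wae.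
Qed.

Lemma fine_wmeas_eball_gt0 i x r : 0 < r -> 0 < fine (wmeas mu (w i) (eball x r)).
Proof.
by move=> r0; rewrite fine_gt0// wmeas_eball_gt0//= ltey_eq wmeas_eball_fin.
Qed.

(** Write b = |B|, V = avg(v_omega), d_i for the dual factors. Hoelder yields the factors b^(-1/p_i)
    d_i; A_P gives V^(1/p) prod d_i <= C0, and reverse Jensen gives prod (w_i(B)/b)^(1/p_i) <= (K
    V)^(1/p). Multiplying, b and V disappear and K^(1/p) C0 remains; the maximum with 1 keeps the
    constant positive. *)
Lemma prod_avg_le_prod_Lp : A_vec mu pk w -> (forall i, A_infty mu (w i)) ->
  exists2 C : R, 0 < C & forall x r (f : 'I_m -> pt -> R), 0 < r ->
  (forall i, measurable_fun setT (f i)) ->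
  (\big[*%E/1%E]_(i < m) avg mu (eball x r) (fun y => `|f i y|%R) <=
   (C / \prod_(i < m) powR (fine (wmeas mu (w i) (eball x r))) (pk i)^-1)%:E *
   \big[*%E/1%E]_(i < m) Lp_w mu (pk i) (w i) (eball x r) (f i))%E.
Proof.
move=> [C0 HC0] wA.
have [K K0 HK] := prod_avg_le_avg_v_omega Hmu m0 pk1 ww wA.
have p0 := exp_p_gt0; set p := exp_p pk in p0.
exists (K `^ p^-1 * Num.max C0 1).
  by rewrite mulr_gt0 ?powR_gt0// lt_max ltr01 orbT.
move=> x r f r0 mf; set B := eball x r.
have mB : measurable B by exact: measurable_eball.
have B0 : (0 < mu B < +oo)%E by exact: mu_eball_bounds.
set b := fine (mu B); have b0 : 0 < b by exact: fine_mu_eball_gt0.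
have dual0 i : (0 < dual_avg mu (pk i) (w i) B)%E.
  by have [mw w0 _ wae] := ww i; exact: dual_avg_gt0.
have W0 i := fine_wmeas_eball_gt0 i x r0.
have := HC0 x r r0; rewrite -/p -/B.
rewrite [X in (_ * X)%E](_ : _ =
  \big[*%E/1%E]_(i < m) dual_avg mu (pk i) (w i) B)//.
have := HK x r r0; rewrite -/p -/B.
have avgw i : fine (avg mu B (w i)) = fine (wmeas mu (w i) B) / b.
  by rewrite /avg fineM ?wmeas_eball_fin// mulrC.
have prodw0 : 0 < \prod_(i < m) fine (avg mu B (w i)) `^ (p / pk i).
  by apply: prodr_gt0 => i _; rewrite powR_gt0// avgw divr_gt0.
have dualprod0 : (0 < \big[*%E/1%E]_(i < m) dual_avg mu (pk i) (w i) B)%E.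
  exact: prode_gt0.
(* V = +oo contradicts A_P because the dual factors are positive; V = -oo contradicts the positive
   lower bound from reverse Jensen. *)
case: (avg mu B (v_omega pk w)) => [V| |]; last 2 first.
- move=> _; rewrite poweRyr; last by rewrite gt_eqF// invr_gt0.
  by rewrite gt0_mulye// leye_eq.
- by rewrite gt0_muleNy ?lte_fin// leeNy_eq.
rewrite -EFinM lee_fin => HV.
have V0 : 0 < V by rewrite -(pmulr_rgt0 _ K0); exact: lt_le_trans HV.
rewrite poweR_EFin => HVd.
have dualoo : forall i, (dual_avg mu (pk i) (w i) B < +oo)%E.
  apply: prode_lty_inv => //; rewrite -lee_pdivlMl ?powR_gt0// in HVd.
  by apply: le_lt_trans HVd _; rewrite -EFinM ltry.
pose d i := fine (dual_avg mu (pk i) (w i) B).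
have dE i : dual_avg mu (pk i) (w i) B = (d i)%:E.
  by rewrite fineK// ge0_fin_numE// ltW.
have d0 i : 0 < d i by rewrite -lte_fin -dE.
move: HVd; rewrite (eq_bigr (fun i => (d i)%:E))// prodEFin -EFinM lee_fin => HVd.
apply: (@le_trans _ _ (\big[*%E/1%E]_(i < m)
    ((powR b (- (pk i)^-1) * d i)%:E * Lp_w mu (pk i) (w i) B (f i)))%E).
  apply: lee_prod => i _; rewrite avg_ge0//=.
  have [mw w0 _ wae] := ww i.
  rewrite EFinM -muleA [X in (_ * X)%E]muleC muleA -dE.
  exact: avg_le_Lp.
rewrite big_split/= prodEFin; apply: lee_wpmul2r.
  by apply: prode_ge0 => i _; exact: Lp_w_ge0.
rewrite lee_fin ler_pdivlMr; last first.
  by apply: prodr_gt0 => i _; rewrite powR_gt0.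
have {}HV : \prod_(i < m) (fine (wmeas mu (w i) B) / b) `^ (pk i)^-1 <=
    K `^ p^-1 * V `^ p^-1.
  rewrite -powRM ?(ltW K0) ?(ltW V0)//.
  have -> : \prod_(i < m) (fine (wmeas mu (w i) B) / b) `^ (pk i)^-1 =
      (\prod_(i < m) fine (avg mu B (w i)) `^ (p / pk i)) `^ p^-1.
    rewrite powR_prod => [|i _]; last exact: powR_ge0.
    apply: eq_bigr => i _; rewrite -avgw -powRrM; congr powR.
    by rewrite mulrAC mulfV ?mul1r// gt_eqF.
  apply: ge0_ler_powR => //; rewrite ?nnegrE.
  - by rewrite invr_ge0 ltW.
  - exact: ltW.
  - by rewrite mulr_ge0 ?(ltW K0) ?(ltW V0).
apply: (@le_trans _ _ (\prod_(i < m) (fine (wmeas mu (w i) B) / b) `^ (pk i)^-1 *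
    \prod_(i < m) d i)).
  rewrite -!big_split/= le_eqVlt; apply/orP; left; apply/eqP.
  apply: eq_bigr => i _.
  rewrite powRM ?invr_ge0 ?(ltW b0) ?(ltW (W0 _))// powR_invl ?(ltW b0)// powRN.
  by rewrite mulrAC [_^-1 * _]mulrC.
apply: (@le_trans _ _ (K `^ p^-1 * V `^ p^-1 * \prod_(i < m) d i)).
  by rewrite ler_wpM2r// prodr_ge0// => i _; rewrite ltW.
rewrite -mulrA ler_wpM2l ?powR_ge0//.
by rewrite (le_trans HVd)// le_max lexx.
Qed.

End prod_avg.

(* g need not be measurable: the integral of a nonnegative function is the supremum of
   the integrals of the simple functions below it. *)
Lemma ge0_le_integral_nomeas d (T : measurableType d) (R : realType)
    (mu : {measure set T -> \bar R}) (D : set T) (f g : T -> \bar R) :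
  (forall x, D x -> (0 <= f x)%E) -> (forall x, D x -> (f x <= g x)%E) ->
  (\int[mu]_(x in D) f x <= \int[mu]_(x in D) g x)%E.
Proof.
move=> f0 fg; rewrite !ge0_integralE//; last first.
  by move=> x Dx; exact: le_trans (f0 _ Dx) (fg _ Dx).
apply: ereal_sup_le => _ [h /= hf <-]; exists h => // x.
apply: le_trans (hf x) _; rewrite !patchE; case: ifPn => // xD.
by apply: fg; exact: set_mem.
Qed.

(** * Dyadic sums as lower Riemann sums *)

Section dyadic_sum.
Context (R : realType).
Local Notation leb := (@lebesgue_measure R).
Variables (r : R) (c : nat -> \bar R) (F : R -> \bar R).
Hypotheses (r0 : 0 < r) (c0 : forall j, (0 <= c j)%E)
  (F0 : forall t, r < t -> (0 <= F t)%E).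
Hypothesis cF : forall j t, 2 ^+ j.+1 * r < t <= 2 ^+ j.+2 * r -> (c j <= F t)%E.

Let I j : set R := `]2 ^+ j.+1 * r, 2 ^+ j.+2 * r]%classic.

(** The intervals [I j] are disjoint, so at most one summand is nonzero at t, and [cF] bounds it; if
    there is none, F t >= 0 suffices. *)
Let step_le J t : r < t ->
  (\sum_(1 <= j < J) c j * (\1_(I j) t)%:E <= F t)%E.
Proof.
move=> rt; elim: J => [|J IH]; first by rewrite big_geq ?F0.
case: (ltnP 0 J) => J0; last by rewrite big_geq ?F0// ltnS.
rewrite big_nat_recr//=; case: (boolP (t \in I J)) => tJ; last first.
  by rewrite indicE (negbTE tJ) mule0 adde0.
rewrite indicE tJ mule1 big_nat_cond big1 ?add0e; last first.
  move=> j /andP[/andP[_ jJ] _]; rewrite indicE memNset ?mule0//.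
  move: tJ; rewrite inE /I /= !in_itv/= => /andP[+ _] /andP[_] tj.
  rewrite ltNge => /negP; apply; apply: le_trans tj _.
  by rewrite ler_pM2r// ler_eXn2l ?ltr1n// ltnS.
by apply: cF; move: tJ; rewrite inE /I /= in_itv.
Qed.

(** The weight 2^(j+1) r is the length of [I j], so the left side is the integral of the step
    function in [step_le]. *)
Lemma dyadic_sum_le_integral J :
  (\sum_(1 <= j < J) c j * (2 ^+ j.+1 * r)%:E <=
   \int[leb]_(t in [set t : R | (r < t)%R]) F t)%E.
Proof.
have mr : measurable ([set t | r < t] : set R).
  by rewrite -set_itvoy; exact: measurable_itv.
have m1 j : measurable_fun [set t : R | r < t] (fun t => (\1_(I j) t)%:E : \bar R).
  by apply/measurable_EFinP; apply: measurable_funTS;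
    apply: measurable_indic; exact: measurable_itv.
apply: (@le_trans _ _ (\int[leb]_(t in [set t : R | (r < t)%R])
    (\sum_(1 <= j < J) c j * (\1_(I j) t)%:E))%E); last first.
  apply: ge0_le_integral_nomeas => // t rt; last exact: step_le.
  by apply: sume_ge0 => j _; rewrite mule_ge0// lee_fin.
rewrite ge0_integral_sum//; last 2 first.
- by move=> j; apply: measurable_funeM; exact: m1.
- by move=> j t _; rewrite mule_ge0// lee_fin.
apply: lee_sum => j _; rewrite ge0_integralZl//; last exact: m1.
apply: lee_wpmul2l => //; rewrite integral_indic// ?setIidl.
- rewrite -[leRHS]/(lebesgue_measure (I j)) /I lebesgue_measure_itv/=.
  rewrite lte_fin ltr_pM2r// ltr_eXn2l ?ltr1n// ltnSn.
  by rewrite -EFinD lee_fin [2 ^+ j.+2]exprS -mulrA mulr_natl mulr2n addrK.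
- move=> t; rewrite /I /= in_itv/= => /andP[+ _]; apply: le_lt_trans.
  by rewrite ler_peMl ?(ltW r0)// exprn_ege1// ler1n.
- exact: measurable_itv.
Qed.

Lemma dyadic_series_le_integral :
  (\sum_(1 <= j <oo) c j * (2 ^+ j.+1 * r)%:E <=
   \int[leb]_(t in [set t : R | (r < t)%R]) F t)%E.
Proof.
apply: lime_le.
  apply: is_cvg_nneseries => j _ _; rewrite mule_ge0// lee_fin.
  by rewrite mulr_ge0// ltW.
by apply: nearW => J; exact: dyadic_sum_le_integral.
Qed.

End dyadic_sum.

(** * From Morrey norms to the dyadic series of averages *)

Section morrey_growth.
Context (R : realType) (n : nat) (mu : {measure set (n.-tuple R) -> \bar R}).
Hypothesis Hmu : is_lebesgue_measure mu.
Local Notation pt := (n.-tuple R).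

Lemma measurable_Lp_integrand p (w f : pt -> R) : measurable_fun setT w ->
  measurable_fun setT f -> measurable_fun setT (fun y => powR `|f y| p * w y).
Proof.
move=> mw mf; apply: measurable_funM => //.
by apply: (measurableT_comp (measurable_powR _)); exact: measurableT_comp.
Qed.

Lemma Lp_w_le_ball p (w f : pt -> R) x r s : 0 < p -> r <= s ->
  measurable_fun setT w -> (forall y, 0 <= w y) -> measurable_fun setT f ->
  (Lp_w mu p w (eball x r) f <= Lp_w mu p w (eball x s) f)%E.
Proof.
move=> p0 rs mw w0 mf; rewrite /Lp_w.
have Lge0 A : (0 <= \int[mu]_(y in A) (`|f y| `^ p * w y)%:E)%E.
  by apply: integral_ge0 => y _; rewrite lee_fin mulr_ge0// powR_ge0.
apply: gt0_ler_poweR; rewrite ?invr_ge0 ?(ltW p0)// ?in_itv/= ?leey ?andbT//.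
apply: ge0_subset_integral; [exact: measurable_eball|exact: measurable_eball| | |].
- by apply/measurable_EFinP; apply: measurable_funTS; exact: measurable_Lp_integrand.
- by move=> y _; rewrite lee_fin mulr_ge0// powR_ge0.
- exact: subset_eball.
Qed.

(** The integral grows with the ball, and doubling bounds the ratio of the two measures by the
    constant. *)
Lemma avg_le_ball (f : pt -> R) x s t : 0 < s -> s <= t -> t <= 2 * s ->
  measurable_fun setT f -> (forall y, 0 <= f y) ->
  (avg mu (eball x s) f <= ((2 * n.+1%:R) ^+ n)%:E * avg mu (eball x t) f)%E.
Proof.
move=> s0 st ts mf f0; have t0 : 0 < t by exact: lt_le_trans st.
rewrite /avg muleA -EFinM.
apply: lee_pmul; rewrite ?lee_fin ?invr_ge0 ?fine_ge0//.
- by apply: integral_ge0 => y _; rewrite lee_fin.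
- rewrite -[leLHS]mul1r ler_pdivrMr ?fine_mu_eball_gt0// mulrAC.
  rewrite ler_pdivlMr ?fine_mu_eball_gt0// mul1r.
  exact: mu_eball_doubling.
- apply: ge0_subset_integral; [exact: measurable_eball|exact: measurable_eball| | |].
  + by apply/measurable_EFinP; exact: measurable_funTS.
  + by move=> y _; rewrite lee_fin.
  + exact: subset_eball.
Qed.

Lemma morrey_norm_ge0 p phi (w f : pt -> R) x0 : (forall r, 0 < r -> 0 < phi x0 r) ->
  (0 <= morrey_norm mu p phi w x0 f)%E.
Proof.
move=> phi0; apply: le_trans (ereal_sup_ubound _); last first.
  by exists 1; first by rewrite /= in_itv/= ltr01.
by rewrite /= mule_ge0 ?Lp_w_ge0// lee_fin mulr_ge0 ?powR_ge0// invr_ge0 ltW// phi0.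
Qed.

Lemma Lp_w_le_morrey_norm p phi (w f : pt -> R) x0 r : 0 < r -> 0 < phi x0 r ->
  is_weight mu w ->
  (Lp_w mu p w (eball x0 r) f <=
   (phi x0 r * powR (fine (wmeas mu w (eball x0 r))) p^-1)%:E *
   morrey_norm mu p phi w x0 f)%E.
Proof.
move=> r0 phi0 ww.
have W0 : 0 < fine (wmeas mu w (eball x0 r)).
  (* The single weight is viewed as a family indexed by ['I_1]. *)
  exact: (@fine_wmeas_eball_gt0 _ _ _ Hmu 1 (fun=> w) (fun=> ww) ord0).
set W := fine _ in W0 *; have Wp : 0 < W `^ p^-1 by exact: powR_gt0.
rewrite -lee_pdivrMl ?mulr_gt0//.
apply: ereal_sup_ubound; exists r => /=; first by rewrite in_itv/= r0.
by rewrite -/W powRN invfM.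
Qed.

Lemma le_ess_inf_gt (t : R) (g : R -> R) (a : \bar R) :
  (forall eta, t < eta -> (a <= (g eta)%:E)%E) -> (a <= ess_inf_gt t g)%E.
Proof.
move=> ag; apply: ereal_sup_ubound => /=.
rewrite (_ : [set x | _] = set0); first exact: negligible_set0.
by apply/seteqP; split=> // x /= [/ag]; rewrite leNgt => /negP.
Qed.

Context (m : nat) (pk : 'I_m -> R) (w : 'I_m -> pt -> R) (x0 : pt).
Hypotheses (m0 : (0 < m)%N) (pk1 : forall i, 1 <= pk i).
Hypotheses (ww : forall i, is_weight mu (w i)).
Context (phi1 : 'I_m -> pt -> R -> R).
Hypothesis phi1_gt0 : forall i x (r : R), 0 < r -> 0 < phi1 i x r.

Definition wprod t := \prod_(i < m)
  powR (fine (wmeas mu (w i) (eball x0 t))) (pk i)^-1.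
Definition phi_wprod t := \prod_(i < m)
  (phi1 i x0 t * powR (fine (wmeas mu (w i) (eball x0 t))) (pk i)^-1).
(** The integrand of the condition on (phi_1, phi_2), with the 1/t of dt/t absorbed into the last
    factor. *)
Definition growth t : \bar R :=
  (ess_inf_gt t phi_wprod * ((t * wprod t)^-1)%R%:E)%E.

(** For each eta > t, the norm over B(x0, t) is at most that over B(x0, eta), which the Morrey norm
    controls. The left side does not depend on eta, so the infimum over eta may be taken. *)
Lemma prod_Lp_le_ess_inf (f : 'I_m -> pt -> R) (N t : R) : 0 < t -> 0 < N ->
  (forall i, measurable_fun setT (f i)) ->
  (\big[*%E/1%E]_(i < m) morrey_norm mu (pk i) (phi1 i) (w i) x0 (f i) <= N%:E)%E ->
  (\big[*%E/1%E]_(i < m) Lp_w mu (pk i) (w i) (eball x0 t) (f i) <=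
   N%:E * ess_inf_gt t phi_wprod)%E.
Proof.
move=> t0 N0 mf HN; rewrite -lee_pdivrMl//; apply: le_ess_inf_gt => eta teta.
have eta0 : 0 < eta by exact: lt_trans teta.
rewrite lee_pdivrMl//; apply: (@le_trans _ _ (\big[*%E/1%E]_(i < m)
    ((phi1 i x0 eta * powR (fine (wmeas mu (w i) (eball x0 eta))) (pk i)^-1)%:E *
     morrey_norm mu (pk i) (phi1 i) (w i) x0 (f i)))%E).
  apply: lee_prod => i _; rewrite Lp_w_ge0/=.
  apply: (@le_trans _ _ (Lp_w mu (pk i) (w i) (eball x0 eta) (f i))).
    have [mw w0 _ _] := ww i.
    by apply: Lp_w_le_ball => //; [exact: pk_gt0|exact: ltW].
  by apply: Lp_w_le_morrey_norm => //; exact: phi1_gt0.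
rewrite big_split/= prodEFin -/(phi_wprod eta) muleC; apply: lee_wpmul2r => //.
rewrite lee_fin; apply: prodr_ge0 => i _.
by rewrite mulr_ge0 ?powR_ge0// ltW// phi1_gt0.
Qed.

(** For t in (2^(j+1) r, 2^(j+2) r], doubling replaces the j-th term by averages over B(x0, t), so
    it is at most M N t growth(t) with M = D^m C0. This is the hypothesis of the Riemann-sum
    comparison once t is replaced by the right endpoint. *)
Lemma dyadic_avg_series_le : A_vec mu pk w -> (forall i, A_infty mu (w i)) ->
  exists2 C : R, 0 < C & forall (f : 'I_m -> pt -> R) (N r : R), 0 < r -> 0 < N ->
  (forall i, measurable_fun setT (f i)) ->
  (\big[*%E/1%E]_(i < m) morrey_norm mu (pk i) (phi1 i) (w i) x0 (f i) <= N%:E)%E ->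
  (\sum_(1 <= j <oo) \big[*%E/1%E]_(i < m)
     avg mu (eball x0 (2 ^+ j.+1 * r)%R) (fun y => `|f i y|%R) <=
   (C * N)%:E * \int[@lebesgue_measure R]_(t in [set t : R | (r < t)%R]) growth t)%E.
Proof.
move=> HA wA; have [C0 C00 HC0] := prod_avg_le_prod_Lp Hmu m0 pk1 ww HA wA.
pose D : R := (2 * n.+1%:R) ^+ n; have D0 : 0 < D by rewrite exprn_gt0.
pose M := D ^+ m * C0; have M0 : 0 < M by rewrite mulr_gt0// exprn_gt0.
exists (2 * M); first by rewrite mulr_gt0.
move=> f N r r0 N0 mf HN.
have W0 t : 0 < t -> 0 < wprod t.
  by move=> t0; apply: prodr_gt0 => i _; rewrite powR_gt0// fine_wmeas_eball_gt0.
pose A j := (\big[*%E/1%E]_(i < m)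
     avg mu (eball x0 (2 ^+ j.+1 * r)%R) (fun y => `|f i y|%R))%E.
have A0 j : (0 <= A j)%E.
  apply: prode_ge0 => i _; apply: avg_ge0 => //; exact: measurable_eball.
have s0 j : 0 < 2 ^+ j * r by rewrite mulr_gt0// exprn_gt0.
have key j t : 2 ^+ j.+1 * r < t <= 2 ^+ j.+2 * r ->
    (A j <= (M * N * (2 ^+ j.+2 * r))%:E * growth t)%E.
  move=> /andP[st ts]; have t0 : 0 < t by exact: lt_trans st.
  apply: (@le_trans _ _ ((D ^+ m)%:E *
      \big[*%E/1%E]_(i < m) avg mu (eball x0 t) (fun y => `|f i y|%R))%E).
    have -> : D ^+ m = \prod_(i < m) D by rewrite prodr_const card_ord.
    rewrite -prodEFin -big_split/=; apply: lee_prod => i _.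
    rewrite avg_ge0//=; last exact: measurable_eball.
    apply: avg_le_ball => //; first exact: ltW.
      by rewrite mulrA -exprS.
    exact: measurableT_comp.
  apply: (@le_trans _ _ ((D ^+ m)%:E * ((C0 / wprod t)%:E * (N%:E * ess_inf_gt t phi_wprod)))%E).
    apply: lee_wpmul2l; first by rewrite lee_fin exprn_ge0// ltW.
    apply: le_trans (HC0 _ _ _ t0 mf) _; apply: lee_wpmul2l.
      by rewrite lee_fin divr_ge0// ltW// W0.
    exact: prod_Lp_le_ess_inf.
  have E0 : (0 <= ess_inf_gt t phi_wprod)%E.
    apply: le_ess_inf_gt => eta teta; rewrite lee_fin; apply: prodr_ge0 => i _.
    by rewrite mulr_ge0 ?powR_ge0// ltW// phi1_gt0// (lt_trans t0).
  rewrite /growth [X in (_ <= _ * X)%E]muleC !muleA -!EFinM; apply: lee_wpmul2r => //.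
  rewrite lee_fin /M invfM.
  (* A factor t t^(-1) is inserted to produce the 1/t of [growth]; the remaining t is bounded by
     2^(j+2) r. *)
  have -> : D ^+ m * (C0 / wprod t) * N = D ^+ m * C0 * N * (t * (t^-1 / wprod t)).
    by rewrite mulVKf ?gt_eqF// mulrA mulrAC.
  rewrite -[leRHS]mulrA; apply: ler_wpM2l; first by rewrite !mulr_ge0 ?exprn_ge0 ?ltW.
  by apply: ler_wpM2r => //; rewrite divr_ge0 ?invr_ge0 ?ltW// W0.
have F0 t : r < t -> (0 <= growth t)%E.
  move=> rt; have t0 : 0 < t by exact: lt_trans rt.
  apply: mule_ge0; last first.
    by rewrite lee_fin invr_ge0 mulr_ge0 ?(ltW t0)// ltW// W0.
  apply: le_ess_inf_gt => eta teta; rewrite lee_fin; apply: prodr_ge0 => i _.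
  by rewrite mulr_ge0 ?powR_ge0// ltW// phi1_gt0// (lt_trans t0).
pose c j := ((M * N * (2 ^+ j.+2 * r))^-1%:E * A j)%E.
have K0 j : 0 < M * N * (2 ^+ j.+2 * r) by rewrite mulr_gt0// mulr_gt0.
have c0 j : (0 <= c j)%E by rewrite mule_ge0// lee_fin invr_ge0 ltW.
have cF j t : 2 ^+ j.+1 * r < t <= 2 ^+ j.+2 * r -> (c j <= growth t)%E.
  by move=> h; rewrite /c lee_pdivrMl//; exact: key.
have := dyadic_series_le_integral r0 c0 F0 cF.
(* The interval length 2^(j+1) r is half the endpoint 2^(j+2) r occurring in [c], whence the 2 in
   the constant 2 M. *)
have cE j : (c j * (2 ^+ j.+1 * r)%:E = (2 * M * N)^-1%:E * A j)%E.
  rewrite /c muleAC -EFinM; congr (_%:E * _)%E.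
  by rewrite [2 ^+ j.+2]exprS -mulrA; field; rewrite !gt_eqF.
under eq_eseriesr do rewrite cE.
rewrite nneseriesZl//.
by rewrite lee_pdivrMl//; apply: mulr_gt0 => //; exact: mulr_gt0.
Qed.

End morrey_growth.

(** * Monotonicity, quasi-additivity and Chebyshev's inequality *)

Section morrey_norms.
Context (R : realType) (n : nat) (mu : {measure set (n.-tuple R) -> \bar R}).
Hypothesis Hmu : is_lebesgue_measure mu.
Local Notation pt := (n.-tuple R).

Lemma le_morrey_norm p phi (w f g : pt -> R) x0 : 0 < p ->
  (forall r, 0 < r -> 0 < phi x0 r) ->
  measurable_fun setT w -> (forall x, 0 <= w x) ->
  measurable_fun setT f -> measurable_fun setT g ->
  (forall x, `|g x| <= `|f x|) ->
  (morrey_norm mu p phi w x0 g <= morrey_norm mu p phi w x0 f)%E.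
Proof.
move=> p0 phi0 mw w0 mf mg gf; apply: ge_ereal_sup => _ [r /= r0 <-].
apply: le_trans (ereal_sup_ubound _); last by exists r.
move: r0; rewrite in_itv/= andbT => r0.
apply: lee_wpmul2l.
  by rewrite lee_fin mulr_ge0 ?powR_ge0// invr_ge0 ltW// phi0.
have Lge0 (h : pt -> R) : (0 <= \int[mu]_(y in eball x0 r) (`|h y| `^ p * w y)%:E)%E.
  by apply: integral_ge0 => y _; rewrite lee_fin mulr_ge0// powR_ge0.
rewrite /Lp_w; apply: gt0_ler_poweR.
- by rewrite invr_ge0 ltW.
- by rewrite in_itv/= Lge0 leey.
- by rewrite in_itv/= Lge0 leey.
apply: ge0_le_integral_nomeas => y _; rewrite lee_fin ?mulr_ge0 ?powR_ge0//.
by apply: ler_wpM2r => //; apply: ge0_ler_powR; rewrite ?nnegrE ?(ltW p0).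
Qed.

(** Makes the hypotheses on T applicable to the functions cut by [cut_in] and [cut_out]. *)
Lemma in_morrey_indic p phi (w f : pt -> R) x0 (A : set pt) : 0 < p ->
  (forall r, 0 < r -> 0 < phi x0 r) -> is_weight mu w -> measurable A ->
  in_morrey mu p phi w x0 f -> in_morrey mu p phi w x0 (fun y => f y * \1_A y).
Proof.
move=> p0 phi0 [mw w0 _ _] mA [mf foo].
have mg : measurable_fun setT (fun y => f y * \1_A y).
  by apply: measurable_funM => //; exact: measurable_indic.
split; first exact: mg.
apply: le_lt_trans foo.
apply: (le_morrey_norm p0 phi0 mw w0 mf mg) => x.
rewrite normrM ler_piMr// indicE; case: (x \in A); rewrite ?normr1 ?normr0//.
Qed.

(** The p-th power of [Lp_w]: for every p > 0, also below 1, it is subadditive up to the factor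
    2^p. *)
Definition Ip p (w : pt -> R) (B : set pt) (f : pt -> R) : \bar R :=
  (\int[mu]_(y in B) (powR `|f y| p * w y)%:E)%E.

Lemma Ip_ge0 p w B f : (forall x, 0 <= w x) -> (0 <= Ip p w B f)%E.
Proof.
by move=> w0; apply: integral_ge0 => y _; rewrite lee_fin mulr_ge0// powR_ge0.
Qed.

Lemma measurable_Ip p (w f : pt -> R) B : measurable_fun setT w ->
  measurable_fun setT f ->
  measurable_fun B (fun y => (powR `|f y| p * w y)%:E).
Proof.
move=> mw mf; apply/measurable_EFinP; apply: measurable_funTS.
exact: measurable_Lp_integrand.
Qed.

Lemma Ip_quasi_additive p (w f g h : pt -> R) (B : set pt) : 0 < p ->
  measurable B -> measurable_fun setT w -> (forall x, 0 <= w x) ->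
  measurable_fun setT f -> measurable_fun setT g -> measurable_fun setT h ->
  {ae mu, forall x, `|f x| <= `|g x| + `|h x|} ->
  (Ip p w B f <= (2 `^ p)%:E * (Ip p w B g + Ip p w B h))%E.
Proof.
move=> p0 mB mw w0 mf mg mh fgh.
have Jge0 (k : pt -> R) y : (0%:E <= (`|k y| `^ p * w y)%:E)%E.
  by rewrite lee_fin mulr_ge0// powR_ge0.
have mI (k : pt -> R) : measurable_fun setT k ->
    measurable_fun B (fun y => (`|k y| `^ p * w y)%:E) by exact: measurable_Ip.
rewrite /Ip -ge0_integralD//; [|exact: mI|exact: mI].
rewrite -ge0_integralZl_EFin ?powR_ge0//; last 2 first.
- by move=> y _; rewrite adde_ge0.
- by apply: emeasurable_funD; exact: mI.
apply: ae_ge0_le_integral => //.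
- exact: mI.
- by move=> y _; rewrite mule_ge0 ?adde_ge0// lee_fin powR_ge0.
- by apply: measurable_funeM; apply: emeasurable_funD; exact: mI.
apply: filterS fgh => y fghy _.
rewrite -EFinD -EFinM lee_fin -mulrDl mulrA; apply: ler_wpM2r => //.
(* (a + b)^p <= (2 max(a, b))^p <= 2^p (a^p + b^p), for p on either side of 1. *)
set a := `|g y|; set b := `|h y|; set c := Num.max a b.
have c0 : 0 <= c by rewrite le_max normr_ge0.
apply: (@le_trans _ _ ((2 * c) `^ p)).
  apply: ge0_ler_powR; rewrite ?nnegrE ?mulr_ge0 ?(ltW p0)//.
  apply: le_trans fghy _; rewrite mulr_natl mulr2n lerD// le_max lexx ?orbT//.
rewrite powRM//; apply: ler_wpM2l; first exact: powR_ge0.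
rewrite /c; case: (leP a b) => _; first by rewrite lerDr powR_ge0.
by rewrite lerDl powR_ge0.
Qed.

Lemma Ip_le_ae_bound p (w f : pt -> R) x r Q : 0 < p -> 0 < r -> 0 <= Q ->
  is_weight mu w -> measurable_fun setT f ->
  {ae mu, forall y, eball x r y -> `|f y| <= Q} ->
  (Ip p w (eball x r) f <= (Q `^ p * fine (wmeas mu w (eball x r)))%:E)%E.
Proof.
move=> p0 r0 Q0 ww mf fQ; have [mw w0 wi _] := ww.
have mB := measurable_eball x r.
have mwB : measurable_fun (eball x r) (EFin \o w).
  by apply/measurable_EFinP; exact: measurable_funTS.
rewrite EFinM fineK; last first.
  exact: (integrable_fin_num (measurable_eball x r) (wi _ _ r0)).
rewrite /wmeas -ge0_integralZl_EFin ?powR_ge0//; last first.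
  by move=> y _; rewrite lee_fin.
apply: ae_ge0_le_integral => //.
- by move=> y _; rewrite lee_fin mulr_ge0// powR_ge0.
- exact: measurable_Ip.
- by move=> y _; rewrite -EFinM lee_fin mulr_ge0// powR_ge0.
- exact: measurable_funeM.
apply: filterS fQ => y /[apply] fQ; rewrite -EFinM lee_fin.
by apply: ler_wpM2r => //; apply: ge0_ler_powR; rewrite ?nnegrE ?(ltW p0).
Qed.

(** Monotonicity of powers, both ways. With V the weight of a ball, Q V^(1/p) is the shape of a
    Morrey bound at one radius. *)
Lemma Lp_w_le_Ip p (w f : pt -> R) B (Q V : R) : 0 < p ->
  (forall x, 0 <= w x) -> 0 <= Q -> 0 <= V ->
  (Lp_w mu p w B f <= (Q * V `^ p^-1)%:E)%E =
  (Ip p w B f <= (Q `^ p * V)%:E)%E.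
Proof.
move=> p0 w0 Q0 V0; have pn0 : p != 0 by rewrite gt_eqF.
rewrite /Lp_w -/(Ip p w B f).
have I0 := Ip_ge0 p B f w0; apply/idP/idP => h.
- have -> : Ip p w B f = poweR (poweR (Ip p w B f) p^-1) p.
    by rewrite -poweRrM mulVf// poweRe1.
  have -> : (Q `^ p * V)%:E = poweR (Q * V `^ p^-1)%:E p.
    by rewrite poweR_EFin powRM ?powR_ge0// -powRrM mulVf// powRr1.
  apply: gt0_ler_poweR; rewrite ?(ltW p0)// ?in_itv/= ?leey ?poweR_ge0//.
  by rewrite lee_fin mulr_ge0// powR_ge0.
- have -> : (Q * V `^ p^-1)%:E = poweR (Q `^ p * V)%:E p^-1.
    by rewrite poweR_EFin powRM ?powR_ge0// -powRrM mulfV// powRr1.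
  apply: gt0_ler_poweR; rewrite ?invr_ge0 ?(ltW p0)// ?in_itv/= ?I0 ?leey//.
  by rewrite lee_fin mulr_ge0// powR_ge0.
Qed.

(** Chebyshev: |f|^p >= a^p on the level set E, integrated against w over E. *)
Lemma WLp_w_le_Lp_w p (w f : pt -> R) x r : 0 < p -> 0 < r -> is_weight mu w ->
  measurable_fun setT f ->
  (WLp_w mu p w (eball x r) f <= Lp_w mu p w (eball x r) f)%E.
Proof.
move=> p0 r0 ww mf; have [mw w0 wi _] := ww.
have mB := measurable_eball x r.
apply: ge_ereal_sup => _ [a /= + <-]; rewrite in_itv/= andbT => a0.
set E := [set y | _].
have mE : measurable E.
  have -> : E = eball x r `&` (fun y => `|f y|) @^-1` `]a, +oo[.
    by apply/seteqP; split=> y /=; rewrite in_itv/= andbT.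
  apply: measurableI => //; rewrite -[X in measurable X]setTI.
  have mnf : measurable_fun setT (fun y => `|f y|) by exact: measurableT_comp.
  by apply: mnf => //; exact: measurable_itv.
have EB : E `<=` eball x r by move=> y [].
have mwA A : measurable_fun A (EFin \o w).
  by apply/measurable_EFinP; exact: measurable_funTS.
(* [WLp_w] takes [fine] of w(E), which is faithful only for a finite value; E lies in a ball, where
   w is integrable. *)
have wE : wmeas mu w E \is a fin_num.
  rewrite ge0_fin_numE; last by apply: integral_ge0 => y _; rewrite lee_fin.
  apply: (@le_lt_trans _ _ (wmeas mu w (eball x r))).
    by apply: ge0_subset_integral => // y _; rewrite lee_fin.
  have := integrable_fin_num (measurable_eball x r) (wi _ _ r0).
  by rewrite -/(wmeas mu w (eball x r)) ltey => /fin_numP[].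
have e0 : 0 <= fine (wmeas mu w E).
  by apply/fine_ge0/integral_ge0 => y _; rewrite lee_fin.
have -> : (a * fine (wmeas mu w E) `^ p^-1)%:E =
    poweR (a `^ p * fine (wmeas mu w E))%:E p^-1.
  rewrite poweR_EFin powRM ?powR_ge0// -powRrM mulfV ?gt_eqF// powRr1//.
  exact: ltW.
apply: gt0_ler_poweR; rewrite ?invr_ge0 ?(ltW p0)// ?in_itv/= ?leey ?andbT//.
- by rewrite lee_fin mulr_ge0// powR_ge0.
- exact: Ip_ge0.
apply: (@le_trans _ _ (Ip p w E f)); last first.
  apply: ge0_subset_integral => //; first exact: measurable_Ip.
  by move=> y _; rewrite lee_fin mulr_ge0// powR_ge0.
rewrite EFinM fineK// /wmeas -ge0_integralZl_EFin ?powR_ge0//; last first.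
  by move=> y _; rewrite lee_fin.
apply: ge0_le_integral_nomeas => y yE; rewrite -EFinM lee_fin.
  by rewrite mulr_ge0// powR_ge0.
apply: ler_wpM2r => //; apply: ge0_ler_powR; rewrite ?nnegrE ?(ltW p0) ?(ltW a0)//.
by have [_ /ltW] := yE.
Qed.

Lemma weak_morrey_norm_le p phi (w f : pt -> R) x0 : 0 < p ->
  (forall r, 0 < r -> 0 < phi x0 r) -> is_weight mu w -> measurable_fun setT f ->
  (weak_morrey_norm mu p phi w x0 f <= morrey_norm mu p phi w x0 f)%E.
Proof.
move=> p0 phi0 ww mf; apply: ge_ereal_sup => _ [r /= r0 <-].
apply: le_trans (ereal_sup_ubound _); last by exists r.
move: r0; rewrite in_itv/= andbT => r0.
apply: lee_wpmul2l; last exact: WLp_w_le_Lp_w.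
by rewrite lee_fin mulr_ge0 ?powR_ge0// invr_ge0 ltW// phi0.
Qed.

End morrey_norms.

(** * Splitting the arguments of T and summing the pieces *)

Section sublinear_operator.
Context (R : realType) (n : nat) (mu : {measure set (n.-tuple R) -> \bar R}).
Hypothesis Hmu : is_lebesgue_measure mu.
Local Notation pt := (n.-tuple R).
Context (x0 : pt) (m : nat) (pk : 'I_m -> R) (w : 'I_m -> pt -> R) (v : pt -> R).
Hypotheses (m0 : (0 < m)%N) (pk1 : forall i, 1 <= pk i).
Hypotheses (ww : forall i, is_weight mu (w i)) (vw : is_weight mu v).
Context (phi1 : 'I_m -> pt -> R -> R).
Hypothesis phi1_gt0 : forall i x (r : R), 0 < r -> 0 < phi1 i x r.
Local Notation in_M f :=
  (forall i, in_morrey mu (pk i) (phi1 i) (w i) x0 (f i)).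
Local Notation p := (exp_p pk).
Context (T : ('I_m -> pt -> R) -> pt -> R).
Hypothesis T_meas : forall f, in_M f -> measurable_fun setT (T f).
Hypothesis T_sub : forall (j : 'I_m) f g, in_M f -> in_M g ->
  (forall i, i != j -> f i = g i) ->
  {ae mu, forall x,
    `|T (fun i => if i == j then (fun y => f j y + g j y) else f i) x| <=
    `|T f x| + `|T g x|}.

(* U is the set of coordinates that are not yet split. *)
Definition split_family (U S : {set 'I_m}) (f : 'I_m -> pt -> R) x r i :=
  if i \in U then f i else
  if i \in S then cut_out x r (f i) else cut_in x r (f i).

Lemma in_morrey_split U S f x r : in_M f -> in_M (split_family U S f x r).
Proof.
move=> fM i; rewrite /split_family; case: ifPn => // _.
have p0 := pk_gt0 pk1 i; have mB := measurable_eball x (2 * r).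
case: ifPn => _; apply: in_morrey_indic => //; try by move=> s; exact: phi1_gt0.
exact: measurableC.
Qed.

Lemma cut_outDin x r (f : pt -> R) :
  (fun y => cut_out x r f y + cut_in x r f y) = f.
Proof.
apply/funext => y; rewrite /cut_out /cut_in !indicE in_setC.
by case: (y \in _); rewrite !(mulr1, mulr0, addr0, add0r).
Qed.

(** Induction on the number k of unsplit coordinates: splitting one produces two terms, and
    quasi-additivity costs 2^p, whence a factor 2 * 2^p per coordinate. *)
Lemma Ip_split_family B (M : \bar R) f x r : measurable B -> in_M f ->
  (forall S, (Ip mu p v B (T (split_family finset.set0 S f x r)) <= M)%E) ->
  forall k (U S : {set 'I_m}), #|U| = k ->
  (Ip mu p v B (T (split_family U S f x r)) <=
   ((2 * 2 `^ p) ^+ k)%:E * M)%E.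
Proof.
move=> mB fM HM; elim=> [|k IH] U S Uk.
  by move/eqP: Uk; rewrite finset.cards_eq0 => /eqP->; rewrite expr0 mul1e.
have [j jU] : exists j, j \in U by apply/finset.set0Pn; rewrite -finset.cards_eq0 Uk.
pose U' := (U :\ j)%SET.
have U'k : #|U'| = k by move: Uk; rewrite (finset.cardsD1 j) jU => -[].
(* [split_family] consults S only off U; once j leaves U, its membership in S is set explicitly, to
   the outer part in [a] and to the inner part in [b]. *)
pose a := split_family U' (j |: S)%SET f x r.
pose b := split_family U' (S :\ j)%SET f x r.
have aM : in_M a by exact: in_morrey_split.
have bM : in_M b by exact: in_morrey_split.
have ab i : i != j -> a i = b i.
  move=> ij; rewrite /a /b /split_family !finset.inE ij /=.
  by rewrite (negbTE ij).
have abE : (fun i => if i == j then (fun y => a j y + b j y) else a i) =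
    split_family U S f x r.
  apply/funext => i; case: eqVneq => [->|ij].
    rewrite /a /b /split_family !finset.inE eqxx jU /=.
    exact: cut_outDin.
  by rewrite /a /split_family !finset.inE ij (negbTE ij).
have [mv v0 _ _] := vw.
have := T_sub aM bM ab; rewrite abE => Tab.
have p0 : 0 < p by exact: exp_p_gt0.
have TM := T_meas (@in_morrey_split U S f x r fM).
have q := Ip_quasi_additive p0 mB mv v0 TM (T_meas aM) (T_meas bM) Tab.
apply: le_trans q _.
have -> : (2 * 2 `^ p) ^+ k.+1 = 2 `^ p * (2 * (2 * 2 `^ p) ^+ k).
  by rewrite exprS [RHS]mulrA [2 `^ p * 2]mulrC.
rewrite EFinM -muleA EFinM -[X in (_ <= _ * X)%E]muleA.
apply: lee_wpmul2l; first by rewrite lee_fin powR_ge0.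
by rewrite mule_natl mule2n; apply: leeD; exact: IH.
Qed.

Context (phi2 : pt -> R -> R).
Hypothesis phi2_gt0 : forall x (r : R), 0 < r -> 0 < phi2 x r.
Hypotheses (HA : A_vec mu pk w) (wA : forall i, A_infty mu (w i)).
Hypothesis Hcond : (ereal_sup
  [set ((phi2 x0 r)^-1)%R%:E *
     \int[@lebesgue_measure R]_(t in [set t0 : R | (r < t0)%R])
        growth mu pk w x0 phi1 t
   | r in [set r0 : R | (0 < r0)%R]] < +oo)%E.
Hypothesis T_LS : exists C : R, forall (x : pt) (r : R) f (S : {set 'I_m}),
  0 < r -> in_M f -> S != finset.set0 ->
  (ess_sup_on mu (eball x r)
     (fun y => `|T (fun i => if i \in S then cut_out x r (f i)
                             else cut_in x r (f i)) y|%R)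
   <= C%:E * \sum_(1 <= j <oo)
        \big[*%E/1%E]_(i < m)
           avg mu (eball x (2 ^+ j.+1 * r)%R) (fun y => `|f i y|%R))%E.
Hypothesis T_LB : exists C : R, forall (x : pt) (r : R) f, 0 < r -> in_M f ->
  (morrey_norm mu p phi2 v x0 (T (fun i => cut_in x r (f i)))
   <= C%:E * \big[*%E/1%E]_(i < m) morrey_norm mu (pk i) (phi1 i) (w i) x0 (f i))%E.

Lemma split_set0E S f x r : split_family finset.set0 S f x r =
  fun i => if i \in S then cut_out x r (f i) else cut_in x r (f i).
Proof. by apply/funext => i; rewrite /split_family finset.inE. Qed.

(** For empty S, LB bounds a Morrey norm, which is read off at radius r. For nonempty S, LS and the
    dyadic estimate bound T almost everywhere on B by a multiple of N phi_2(x0, r), and this is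
    integrated against v. *)
Lemma Ip_split_le : exists2 K : R, 0 < K & forall f (N r : R) S,
  0 < r -> 0 < N -> in_M f ->
  (\big[*%E/1%E]_(i < m) morrey_norm mu (pk i) (phi1 i) (w i) x0 (f i) <= N%:E)%E ->
  (Ip mu p v (eball x0 r) (T (split_family finset.set0 S f x0 r)) <=
   ((K * N * phi2 x0 r) `^ p * fine (wmeas mu v (eball x0 r)))%:E)%E.
Proof.
have [C1 HC1] := T_LS; have [C2 HC2] := T_LB.
have [C3 C30 HC3] := dyadic_avg_series_le Hmu x0 m0 pk1 ww phi1_gt0 HA wA.
have p0 : 0 < p by exact: exp_p_gt0.
have [mv v0 vi _] := vw.
have [H H0 HH] : exists2 H : R, 0 <= H & forall r, 0 < r ->
    (\int[@lebesgue_measure R]_(t in [set t0 : R | (r < t0)%R])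
        growth mu pk w x0 phi1 t <= (phi2 x0 r * H)%:E)%E.
  move: Hcond; set s := ereal_sup _ => soo.
  exists (Num.max (fine s) 0); first by rewrite le_max lexx orbT.
  move=> r r0; rewrite EFinM -lee_pdivrMl ?phi2_gt0//.
  apply: (@le_trans _ _ s); first by apply: ereal_sup_ubound; exists r.
  by case: s soo => // [s' _|_]; rewrite ?leNye// lee_fin le_max lexx.
pose D1 := Num.max C1 0; pose D2 := Num.max C2 0.
have D10 : 0 <= D1 by rewrite le_max lexx orbT.
have D20 : 0 <= D2 by rewrite le_max lexx orbT.
(* The first term serves nonempty S, the second empty S; the 1 makes the constant positive. *)
exists (D1 * C3 * H + D2 + 1).
  by rewrite ltr_wpDl// addr_ge0// !mulr_ge0// ltW.
move=> f N r S r0 N0 fM HN.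
set V := fine _; have V0 : 0 < V.
  exact: (@fine_wmeas_eball_gt0 _ _ _ Hmu 1 (fun=> v) (fun=> vw) ord0).
have ph0 := phi2_gt0 x0 r0.
have mT : measurable_fun setT (T (split_family finset.set0 S f x0 r)).
  by apply: T_meas; exact: in_morrey_split.
have K10 : 0 <= D1 * C3 * H by rewrite !mulr_ge0// ltW.
have Kmono K : 0 <= K -> K <= D1 * C3 * H + D2 + 1 ->
   (((K * N * phi2 x0 r) `^ p * V)%:E <=
    (((D1 * C3 * H + D2 + 1) * N * phi2 x0 r) `^ p * V)%:E)%E.
  move=> K0 KK; rewrite lee_fin; apply: ler_wpM2r; first exact: ltW.
  have K'0 := le_trans K0 KK.
  apply: ge0_ler_powR; rewrite ?nnegrE ?(ltW p0)//.
  - by apply: mulr_ge0; [apply: mulr_ge0|] => //; exact: ltW.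
  - by apply: mulr_ge0; [apply: mulr_ge0|] => //; exact: ltW.
  - by apply: ler_wpM2r; [exact: ltW|apply: ler_wpM2r => //; exact: ltW].
have [S0|S0] := eqVneq S finset.set0.
  apply: (le_trans _ (Kmono D2 D20 _)); last by rewrite -addrA ler_wpDl// lerDl.
  have D2N0 : 0 <= D2 * N * phi2 x0 r.
    by apply: mulr_ge0; [apply: mulr_ge0|] => //; exact: ltW.
  rewrite -Lp_w_le_Ip ?(ltW V0)//.
  apply: le_trans (Lp_w_le_morrey_norm Hmu _ _ r0 ph0 vw) _.
  have -> : split_family finset.set0 S f x0 r = fun i => cut_in x0 r (f i).
    by rewrite split_set0E; apply/funext => i; rewrite S0 finset.inE.
  rewrite -/V [(D2 * N * _)%R]mulrC -mulrA [(D2 * N * _)%R]mulrC mulrA [leRHS]EFinM.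
  apply: lee_wpmul2l; first by rewrite lee_fin mulr_ge0 ?powR_ge0// ltW.
  apply: le_trans (HC2 _ _ _ r0 fM) _; rewrite EFinM.
  have P0 : (0 <= \big[*%E/1%E]_(i < m)
      morrey_norm mu (pk i) (phi1 i) (w i) x0 (f i))%E.
    by apply: prode_ge0 => i _; apply: morrey_norm_ge0 => s; exact: phi1_gt0.
  apply: (@le_trans _ _ (D2%:E * \big[*%E/1%E]_(i < m)
      morrey_norm mu (pk i) (phi1 i) (w i) x0 (f i))%E).
    by apply: lee_wpmul2r => //; rewrite lee_fin le_max lexx.
  exact: lee_wpmul2l.
apply: (le_trans _ (Kmono _ K10 _)); last by rewrite -addrA lerDl addr_ge0.
apply: Ip_le_ae_bound => //.
  by apply: mulr_ge0; [apply: mulr_ge0|] => //; exact: ltW.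
have := HC1 x0 r f S r0 fM S0; rewrite -split_set0E => hsup.
have mf i : measurable_fun setT (f i) by have [] := fM i.
have hser := HC3 f N r r0 N0 mf HN.
have ser0 : (0 <= \sum_(1 <= j <oo) \big[*%E/1%E]_(i < m)
    avg mu (eball x0 (2 ^+ j.+1 * r)%R) (fun y => `|f i y|%R))%E.
  apply: nneseries_ge0 => j _ _; apply: prode_ge0 => i _.
  by apply: avg_ge0 => //; exact: measurable_eball.
have {}hsup : (ess_sup_on mu (eball x0 r)
     (fun y => `|T (split_family finset.set0 S f x0 r) y|%R) <=
    (D1 * C3 * H * N * phi2 x0 r)%:E)%E.
  apply: le_trans hsup _.
  apply: (@le_trans _ _ (D1%:E * ((C3 * N)%:E * (phi2 x0 r * H)%:E))%E).
    apply: (le_trans (lee_wpmul2r ser0 (_ : (C1%:E <= D1%:E)%E))).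
      by rewrite lee_fin le_max lexx.
    apply: lee_wpmul2l; first by rewrite lee_fin.
    apply: le_trans hser _; apply: lee_wpmul2l; last exact: HH.
    by rewrite lee_fin mulr_ge0// ltW.
  by rewrite -!EFinM lee_fin le_eqVlt; apply/orP; left; apply/eqP; ring.
have := ess_sup_on_ge mu (eball x0 r)
  (fun y => `|T (split_family finset.set0 S f x0 r) y|).
by apply: filterS => y /[apply] /le_trans /(_ hsup); rewrite lee_fin.
Qed.

Theorem sublinear_operator_bounded : exists2 K : R, 0 < K & forall f, in_M f ->
  in_morrey mu p phi2 v x0 (T f) /\
  (morrey_norm mu p phi2 v x0 (T f) <=
   K%:E * \big[*%E/1%E]_(i < m) morrey_norm mu (pk i) (phi1 i) (w i) x0 (f i))%E.
Proof.
have [K K0 HK] := Ip_split_le; have p0 : 0 < p by exact: exp_p_gt0.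
(* The p-th root of the loss incurred by splitting all m coordinates. *)
pose c := ((2 * 2 `^ p) ^+ m) `^ p^-1.
have A0 : 0 < 2 * 2 `^ p :> R by rewrite mulr_gt0// powR_gt0.
have c0 : 0 < c by rewrite powR_gt0// exprn_gt0.
have [mv v0 vi _] := vw.
exists (c * K); first by rewrite mulr_gt0.
move=> f fM.
pose P := (\big[*%E/1%E]_(i < m) morrey_norm mu (pk i) (phi1 i) (w i) x0 (f i))%E.
have P0 : (0 <= P)%E.
  by apply: prode_ge0 => i _; apply: morrey_norm_ge0 => s; exact: phi1_gt0.
have Pfin : P \is a fin_num.
  apply: prode_fin_num => i _; rewrite ge0_fin_numE; first by have [] := fM i.
  by apply: morrey_norm_ge0 => s; exact: phi1_gt0.
suff le : (morrey_norm mu p phi2 v x0 (T f) <= (c * K)%:E * P)%E.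
  split=> //; split; first exact: T_meas.
  by apply: le_lt_trans le _; rewrite -(fineK Pfin) -EFinM ltry.
(* P may be 0 while the estimates need N > 0: N exceeds P by e/(c K), which costs exactly e in the
   final bound. *)
apply/lee_addgt0Pr => e e0.
pose N := fine P + e / (c * K).
have cK0 : 0 < c * K by rewrite mulr_gt0.
have N0 : 0 < N by rewrite ltr_wpDl ?divr_gt0// fine_ge0.
have HN : (P <= N%:E)%E by rewrite -(fineK Pfin) lee_fin lerDl ltW// divr_gt0.
have -> : ((c * K)%:E * P + e%:E)%E = (c * K * N)%:E.
  by rewrite -(fineK Pfin) -EFinM -EFinD /N mulrDr [c * K * (e / _)]mulrC divfK ?gt_eqF.
apply: ge_ereal_sup => _ [r /= + <-]; rewrite in_itv/= andbT => r0.
have mB := measurable_eball x0 r.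
set V := fine _; have V0 : 0 < V.
  exact: (@fine_wmeas_eball_gt0 _ _ _ Hmu 1 (fun=> v) (fun=> vw) ord0).
have ph0 := phi2_gt0 x0 r0.
have base S := HK f N r S r0 N0 fM HN.
(* With U the full index set nothing is split yet, so the family is f itself and k = m. *)
have := Ip_split_family mB fM base finset.set0 (finset.cardsT _).
have -> : split_family [set: 'I_m]%SET finset.set0 f x0 r = f.
  by apply/funext => i; rewrite /split_family finset.inE.
rewrite card_ord -EFinM mulrA.
have -> : (2 * 2 `^ p) ^+ m * (K * N * phi2 x0 r) `^ p =
    (c * (K * N * phi2 x0 r)) `^ p.
  rewrite [RHS]powRM ?(ltW c0)//; last first.
    by rewrite mulr_ge0 ?(ltW ph0)// mulr_ge0 ?ltW.
  by rewrite /c -powRrM mulVf ?gt_eqF// powRr1// exprn_ge0// ltW.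
have Q0 : 0 <= c * (K * N * phi2 x0 r).
  by rewrite mulr_ge0 ?(ltW c0)// mulr_ge0 ?(ltW ph0)// mulr_ge0 ?ltW.
rewrite -Lp_w_le_Ip ?(ltW V0)// => h.
have k0 : 0 < (phi2 x0 r)^-1 * V `^ (- p^-1).
  by rewrite mulr_gt0 ?invr_gt0// powR_gt0.
apply: le_trans (lee_wpmul2l _ h) _; first by rewrite lee_fin ltW.
rewrite -EFinM lee_fin powRN le_eqVlt; apply/orP; left; apply/eqP.
have Vp : V `^ p^-1 != 0 by rewrite gt_eqF// powR_gt0.
by field; rewrite Vp gt_eqF.
Qed.

End sublinear_operator.

Unset Implicit Arguments.
Set Strict Implicit.
Set Printing Implicit Defensive.

Theorem theorem1p3 (R : realType) (n : nat)
  (mu : {measure set (n.-tuple R) -> \bar R})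
  (Hmu : is_lebesgue_measure mu) (Hn : (0 < n)%N)
  (x0 : n.-tuple R) (m : nat) (Hm : (0 < m)%N)
  (pk : 'I_m -> R) (Hpk : forall k, 1 <= pk k)
  (w : 'I_m -> n.-tuple R -> R) (v : n.-tuple R -> R)
  (Hw : forall i, is_weight mu (w i)) (Hv : is_weight mu v)
  (HAP : A_vec mu pk w) (HwAinf : forall i, A_infty mu (w i))
  (HvAinf : A_infty mu v)
  (phi1 : 'I_m -> n.-tuple R -> R -> R) (phi2 : n.-tuple R -> R -> R)
  (Hphi1pos : forall i x (r : R), 0 < r -> 0 < phi1 i x r)
  (Hphi2pos : forall x (r : R), 0 < r -> 0 < phi2 x r)
  (Hphi1meas : forall i, measurable_fun ([set: n.-tuple R] `*` (`]0, +oo[%classic : set R))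
                           (fun z : n.-tuple R * R => phi1 i z.1 z.2))
  (Hphi2meas : measurable_fun ([set: n.-tuple R] `*` (`]0, +oo[%classic : set R))
                           (fun z : n.-tuple R * R => phi2 z.1 z.2))
  (Hcond : (ereal_sup
     [set ((phi2 x0 r)^-1)%R%:E *
          \int[@lebesgue_measure R]_(t in [set t0 : R | (r < t0)%R])
             (ess_inf_gt t (fun eta => (\prod_(i < m)
                 (phi1 i x0 eta * powR (fine (wmeas mu (w i) (eball x0 eta))) (pk i)^-1))%R)
              * ((t * \prod_(i < m)
                   powR (fine (wmeas mu (w i) (eball x0 t))) (pk i)^-1)^-1)%R%:E)
     | r in [set r0 : R | (0 < r0)%R]] < +oo)%E)
  (T : ('I_m -> n.-tuple R -> R) -> n.-tuple R -> R)
  (* T is defined on the product of the Morrey spaces, with values in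
     measurable functions *)
  (HTmeas : forall f, (forall i, in_morrey mu (pk i) (phi1 i) (w i) x0 (f i)) ->
      measurable_fun setT (T f))
  (* m-sublinearity *)
  (HTsub : forall (j : 'I_m) f g,
      (forall i, in_morrey mu (pk i) (phi1 i) (w i) x0 (f i)) ->
      (forall i, in_morrey mu (pk i) (phi1 i) (w i) x0 (g i)) ->
      (forall i, i != j -> f i = g i) ->
      {ae mu, forall x, `|T (fun i => if i == j then (fun y => f j y + g j y) else f i) x|
                        <= `|T f x| + `|T g x|})
  (HThom : forall (j : 'I_m) (lam : R) f,
      (forall i, in_morrey mu (pk i) (phi1 i) (w i) x0 (f i)) ->
      {ae mu, forall x, `|T (fun i => if i == j then (fun y => lam * f j y) else f i) x|
                        = `|lam| * `|T f x|})
  (* T \in LS *)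
  (HLS : exists C : R, forall (x : n.-tuple R) (r : R) f (S : {set 'I_m}),
      0 < r ->
      (forall i, in_morrey mu (pk i) (phi1 i) (w i) x0 (f i)) ->
      S != finset.set0 ->
      (ess_sup_on mu (eball x r)
         (fun y => `|T (fun i => if i \in S then cut_out x r (f i)
                                 else cut_in x r (f i)) y|%R)
       <= C%:E * \sum_(1 <= j <oo)
            \big[*%E/1%E]_(i < m)
               avg mu (eball x (2 ^+ j.+1 * r)%R) (fun y => `|f i y|%R))%E)
  (* T \in LB *)
  (HLB : exists C : R, forall (x : n.-tuple R) (r : R) f,
      0 < r ->
      (forall i, in_morrey mu (pk i) (phi1 i) (w i) x0 (f i)) ->
      (morrey_norm mu (exp_p pk) phi2 v x0 (T (fun i => cut_in x r (f i)))
       <= C%:E * \big[*%E/1%E]_(i < m) morrey_norm mu (pk i) (phi1 i) (w i) x0 (f i))%E) :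
  ((forall k, 1 < pk k) ->
     exists C : R, forall f,
       (forall i, in_morrey mu (pk i) (phi1 i) (w i) x0 (f i)) ->
       in_morrey mu (exp_p pk) phi2 v x0 (T f) /\
       (morrey_norm mu (exp_p pk) phi2 v x0 (T f)
        <= C%:E * \big[*%E/1%E]_(i < m) morrey_norm mu (pk i) (phi1 i) (w i) x0 (f i))%E)
  /\
  ((exists k, pk k = 1) ->
     exists C : R, forall f,
       (forall i, in_morrey mu (pk i) (phi1 i) (w i) x0 (f i)) ->
       in_weak_morrey mu (exp_p pk) phi2 v x0 (T f) /\
       (weak_morrey_norm mu (exp_p pk) phi2 v x0 (T f)
        <= C%:E * \big[*%E/1%E]_(i < m) morrey_norm mu (pk i) (phi1 i) (w i) x0 (f i))%E).
Proof.
have [K K0 HK] := sublinear_operator_bounded Hmu Hm Hpk Hw Hv Hphi1pos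
  HTmeas HTsub Hphi2pos HAP HwAinf Hcond HLS HLB.
have p0 : 0 < exp_p pk by exact: exp_p_gt0.
split=> _; exists K => f fM; have [[mTf _] le] := HK f fM; first exact: HK.
have weak_le : (weak_morrey_norm mu (exp_p pk) phi2 v x0 (T f) <=
    morrey_norm mu (exp_p pk) phi2 v x0 (T f))%E.
  apply: weak_morrey_norm_le => // s; exact: Hphi2pos.
have [[_ foo] _] := HK f fM.
split; last exact: le_trans weak_le le.
by split; [exact: mTf|exact: le_lt_trans weak_le foo].
Qed.
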